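(* There is a closed subspace $Y$ of $L_1=L_1[0,1]$ such that $L_1/Y$ is nonzero and has the Daugavet property, but fails to contain a copy of $L_1$ (i.e., no closed subspace of $L_1/Y$ is isomorphic to $L_1$).
   Context: $L_1[0,1]$ is the real $L_1$-space with respect to Lebesgue measure on $[0,1]$. A Banach space $X$ has the Daugavet property if $\|\mathrm{Id}+T\|=1+\|T\|$ for every bounded linear operator $T\colon X\to X$ of rank $1$. *)

(* Defs.v *)
From HB Require Import structures.
From mathcomp Require Import all_boot all_order all_algebra.
From mathcomp Require Import all_classical all_reals all_analysis.
From mathcomp Require Import ess_sup_inf measurable_realfun hoelder.
Import Order.TTheory GRing.Theory Num.Theory.
Import numFieldNormedType.Exports.
Set Implicit Arguments. Unset Strict Implicit. Unset Printing Implicit Defensive.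
Local Open Scope classical_set_scope.
Local Open Scope ring_scope.
Local Open Scope quotient_scope.

(* The library only provides the carrier of the Lp spaces; the vector space
   structure and the norm are those of representatives. *)

HB.instance Definition _ d (T : measurableType d) (R : realType)
    (mu : {measure set T -> \bar R}) (p : \bar R) (p1 : (1 <= p)%E) :=
  gen_eqMixin (LspaceType mu p1).
HB.instance Definition _ d (T : measurableType d) (R : realType)
    (mu : {measure set T -> \bar R}) (p : \bar R) (p1 : (1 <= p)%E) :=
  gen_choiceMixin (LspaceType mu p1).

Section Lspace_normed.
Context d (T : measurableType d) (R : realType).
Variables (mu : {measure set T -> \bar R}) (p : \bar R) (p1 : (1 <= p)%E).
Local Notation F := (LfunType mu p1).
Local Notation L := (LspaceType mu p1).

Lemma ae_eq_Lnorm (f g : T -> R) :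
  measurable_fun [set: T] f -> measurable_fun [set: T] g ->
  f = g %[ae mu] -> ('N[mu]_p[EFin \o f] = 'N[mu]_p[EFin \o g])%E.
Proof.
move=> mf mg fg; rewrite unlock /Lnorm; case: p p1 => [r r1|_|//].
- have mN (h : T -> R) : measurable_fun [set: T] h ->
      measurable_fun [set: T] (fun x => `|(EFin \o h) x| `^ r)%E.
    move=> /measurable_EFinP mh.
    apply: (@measurableT_comp _ _ _ _ _ _ (fun x : \bar R => x `^ r)%E).
      exact: measurable_poweR.
    exact: measurableT_comp.
  congr (_ `^ _)%E; apply: ae_eq_integral => //; [exact: mN..|].
  by apply: filterS fg => x /= /[apply] ->.
- case: ifPn => // _; apply: eq_ess_sup.
  by apply: filterS fg => x /= /(_ I) ->.
Qed.

(* LspaceType is a quotient of {mfun T >-> measurableTypeR R} whereas LfunType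
   extends {mfun T >-> R}: same sigma-algebra, but the structures differ. *)
Section mfunTypeR.
Variable f : {mfun T >-> R}.
Let measurable_mfunTypeR :
  measurable_fun [set: T] ((f : T -> R) : T -> measurableTypeR R).
Proof. exact: (measurable_funPT f). Qed.
#[local] HB.instance Definition _ :=
  isMeasurableFun.Build _ _ _ (measurableTypeR R)
    ((f : T -> R) : T -> measurableTypeR R) measurable_mfunTypeR.
Definition mfunTypeR : {mfun T >-> measurableTypeR R} :=
  (f : T -> R) : T -> measurableTypeR R.
End mfunTypeR.

Lemma mfunTypeRE (f : {mfun T >-> R}) : mfunTypeR f = f :> (T -> R).
Proof. by []. Qed.

Lemma measurable_aeEqMfun (f : {mfun_ mu, T >-> measurableTypeR R}) :
  measurable_fun [set: T] (f : T -> R).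
Proof. exact: (measurable_funPT (repr f)). Qed.

Definition mfun_class (f : {mfun T >-> R}) :
  {mfun_ mu, T >-> measurableTypeR R} :=
  \pi_{mfun_ mu, T >-> measurableTypeR R} (mfunTypeR f).

Lemma mfun_class_ae (f : {mfun T >-> R}) :
  (mfun_class f : T -> R) = f %[ae mu].
Proof. by have /eqP := reprK (mfun_class f); rewrite eqmodE => /asboolP. Qed.

Lemma mfun_classP (f g : {mfun T >-> R}) :
  f = g %[ae mu] -> mfun_class f = mfun_class g.
Proof. by move=> fg; apply/eqP; rewrite eqmodE; apply/asboolP. Qed.

Lemma pi_Lfun_finite (f : F) :
  finite_norm mu p (mfun_class f).
Proof.
rewrite /finite_norm.
rewrite (@ae_eq_Lnorm _ f) //; first exact: Lfunction_finite.
  exact: measurable_aeEqMfun.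
exact: mfun_class_ae.
Qed.

Definition Lfun_class (f : F) : L :=
  LebesgueSpace.Pack (LebesgueSpace.Class
    (@isFinLebesgue.Axioms_ _ _ _ mu p p1 _ (pi_Lfun_finite f))).

Lemma Lspace_repr_subproof (f : L) : (f : T -> R) \in Lfun mu p.
Proof.
rewrite inE; apply/andP; split; rewrite inE/=; last exact: Lebesgue_finite.
exact: measurable_aeEqMfun.
Qed.

Definition Lspace_repr (f : L) : F := Lfun_Sub p1 (Lspace_repr_subproof f).

Lemma Lspace_eqP (f g : L) :
  LebesgueSpace.sort f = LebesgueSpace.sort g -> f = g.
Proof.
case: f g => [f [[hf]]] [g [[hg]]] /= fg; subst g.
by rewrite (Prop_irrelevance hf hg).
Qed.

Lemma Lfun_classK (f : F) : Lspace_repr (Lfun_class f) = f %[ae mu].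
Proof. exact: mfun_class_ae. Qed.

Lemma Lfun_classP (f g : F) : Lfun_class f = Lfun_class g <-> f = g %[ae mu].
Proof.
split=> [fg|fg]; last exact/Lspace_eqP/mfun_classP.
have := Lfun_classK f; rewrite fg => /ae_eq_sym/ae_eq_trans; apply.
exact: Lfun_classK.
Qed.

Lemma Lspace_reprK : cancel Lspace_repr Lfun_class.
Proof.
move=> f; apply/Lspace_eqP; rewrite /= -[RHS]reprK.
apply/eqP; rewrite eqmodE; apply/asboolP.
exact: ae_eq_refl.
Qed.

Lemma ae_LfunD (f f' g g' : F) :
  f = f' %[ae mu] -> g = g' %[ae mu] -> f + g = f' + g' %[ae mu].
Proof.
by apply: filterS2 => x /= + + Dx => /(_ Dx) eqf /(_ Dx) eqg; congr +%R.
Qed.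

Lemma ae_LfunZ a (f f' : F) :
  f = f' %[ae mu] -> a *: f = a *: f' %[ae mu].
Proof. by apply: filterS => x /= + Dx => /(_ Dx) eqf; congr *%R. Qed.

Lemma ae_LfunN (f f' : F) :
  f = f' %[ae mu] -> - f = - f' %[ae mu].
Proof. by apply: filterS => x /= + Dx => /(_ Dx) eqf; congr -%R. Qed.

Definition Lspace_zero : L := Lfun_class 0.
Definition Lspace_opp (f : L) : L := Lfun_class (- Lspace_repr f).
Definition Lspace_add (f g : L) : L :=
  Lfun_class (Lspace_repr f + Lspace_repr g).
Definition Lspace_scale (a : R) (f : L) : L :=
  Lfun_class (a *: Lspace_repr f).
Definition Lspace_norm (f : L) : R := fine ('N[mu]_p[EFin \o (f : T -> R)])%E.

Lemma Lfun_classN : {morph Lfun_class : f / - f >-> Lspace_opp f}.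
Proof. by move=> f; apply/Lfun_classP/ae_LfunN/ae_eq_sym/Lfun_classK. Qed.

Lemma Lfun_classD : {morph Lfun_class : f g / f + g >-> Lspace_add f g}.
Proof.
by move=> f g; apply/Lfun_classP/ae_LfunD; exact/ae_eq_sym/Lfun_classK.
Qed.

Lemma Lfun_classZ a : {morph Lfun_class : f / a *: f >-> Lspace_scale a f}.
Proof. by move=> f; apply/Lfun_classP/ae_LfunZ/ae_eq_sym/Lfun_classK. Qed.

Lemma Lfun_class_norm (f : F) :
  Lspace_norm (Lfun_class f) = fine ('N[mu]_p[EFin \o (f : T -> R)])%E.
Proof.
congr fine; apply: ae_eq_Lnorm => //; first exact: measurable_aeEqMfun.
exact: Lfun_classK.
Qed.

Let addA : associative Lspace_add.
Proof.
move=> f g h; rewrite -(Lspace_reprK f) -(Lspace_reprK g) -(Lspace_reprK h).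
by rewrite -!Lfun_classD addrA.
Qed.

Let addC : commutative Lspace_add.
Proof. by move=> f g; rewrite /Lspace_add addrC. Qed.

Let add0 : left_id Lspace_zero Lspace_add.
Proof.
by move=> f; rewrite -(Lspace_reprK f) -Lfun_classD add0r.
Qed.

Let addN : left_inverse Lspace_zero Lspace_opp Lspace_add.
Proof.
by move=> f; rewrite -(Lspace_reprK f) -Lfun_classN -Lfun_classD addNr.
Qed.

HB.instance Definition _ := GRing.isZmodule.Build L addA addC add0 addN.

Let addE (f g : F) : Lfun_class f + Lfun_class g = Lfun_class (f + g).
Proof. exact/esym/Lfun_classD. Qed.

Let scaleA a b (f : L) :
  Lspace_scale a (Lspace_scale b f) = Lspace_scale (a * b) f.
Proof. by rewrite -(Lspace_reprK f) -!Lfun_classZ scalerA. Qed.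

Let scale1 : left_id 1 Lspace_scale.
Proof. by move=> f; rewrite -(Lspace_reprK f) -Lfun_classZ scale1r. Qed.

Let scaleDr : right_distributive Lspace_scale +%R.
Proof.
move=> a f g; rewrite -(Lspace_reprK f) -(Lspace_reprK g).
by rewrite addE -!Lfun_classZ addE scalerDr.
Qed.

Let scaleDl (f : L) : {morph Lspace_scale^~ f : a b / a + b}.
Proof.
move=> a b; rewrite -(Lspace_reprK f).
by rewrite -!Lfun_classZ addE scalerDl.
Qed.

HB.instance Definition _ :=
  GRing.Zmodule_isLmodule.Build R L scaleA scale1 scaleDr scaleDl.

Let normD (f g : L) : Lspace_norm (f + g) <= Lspace_norm f + Lspace_norm g.
Proof.
rewrite -(Lspace_reprK f) -(Lspace_reprK g) addE !Lfun_class_norm.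
exact: ler_LnormD.
Qed.

Let normZ a (f : L) : Lspace_norm (a *: f) = `|a| * Lspace_norm f.
Proof.
have -> : a *: f = Lfun_class (a *: Lspace_repr f) by [].
rewrite -{2}(Lspace_reprK f) !Lfun_class_norm.
by apply: EFin_inj; rewrite EFinM !finite_norm_fine LnormZ.
Qed.

Let norm0_eq0 (f : L) : Lspace_norm f = 0 -> f = 0.
Proof.
rewrite -(Lspace_reprK f) Lfun_class_norm => /fine_Lnormr_eq0 f0.
exact/Lfun_classP.
Qed.

HB.instance Definition _ := Lmodule_isNormed.Build R L normD normZ norm0_eq0.

End Lspace_normed.

Record closedSubspace (R : realType) (V : normedModType R) := ClosedSubspace {
  closedSubspace_pred :> {pred V} ;
  closedSubspace_submod : GRing.submod_closed closedSubspace_pred ;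
  closedSubspace_closed : closed [set x | x \in closedSubspace_pred] }.

HB.instance Definition _ (R : realType) (V : normedModType R)
    (Y : closedSubspace V) :=
  GRing.isSubmodClosed.Build R V (closedSubspace_pred Y)
    (GRing.submod_closed_semi (closedSubspace_submod Y)).

Section quotient_normed.
Context (R : realType) (V : normedModType R) (Y : closedSubspace V).

Definition quotient_space : Type := Quotient.quot (closedSubspace_pred Y).
Local Notation Q := quotient_space.
HB.instance Definition _ := GRing.Zmodule.on Q.
HB.instance Definition _ := EqQuotient.on Q.

Lemma quotient_eqP (u v : V) : \pi_Q u = \pi_Q v <-> u - v \in Y.
Proof.
by rewrite (Quotient.idealrBE (closedSubspace_pred Y)); split=> /eqP.
Qed.

Let piK (q : Q) : \pi_Q (repr q) = q.
Proof. exact: reprK. Qed.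

Definition quotient_scale (a : R) (q : Q) : Q := \pi_Q (a *: repr q).
Definition quotient_norm (q : Q) : R :=
  inf [set `|v| | v in [set v | \pi_Q v = q]].

Lemma pi_quotientD : {morph \pi_Q : u v / u + v}.
Proof. by move=> u v; exact: (Quotient.pi_add (closedSubspace_pred Y)). Qed.

Lemma pi_quotientZ a : {morph \pi_Q : u / a *: u >-> quotient_scale a u}.
Proof.
move=> u; apply/quotient_eqP; rewrite -scalerBr rpredZ//.
by apply/quotient_eqP; rewrite reprK.
Qed.

Let scaleA a b (q : Q) :
  quotient_scale a (quotient_scale b q) = quotient_scale (a * b) q.
Proof. by rewrite -(piK q) -!pi_quotientZ scalerA. Qed.

Let scale1 : left_id 1 quotient_scale.
Proof. by move=> q; rewrite -(piK q) -pi_quotientZ scale1r. Qed.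

Let scaleDr : right_distributive quotient_scale +%R.
Proof.
move=> a q r; rewrite -(piK q) -(piK r).
by rewrite -pi_quotientD -!pi_quotientZ -pi_quotientD scalerDr.
Qed.

Let scaleDl (q : Q) : {morph quotient_scale^~ q : a b / a + b}.
Proof.
by move=> a b; rewrite -(piK q) -!pi_quotientZ -pi_quotientD scalerDl.
Qed.

HB.instance Definition _ :=
  GRing.Zmodule_isLmodule.Build R Q scaleA scale1 scaleDr scaleDl.

Lemma quotient_norm_le (v : V) : quotient_norm (\pi_Q v) <= `|v|.
Proof.
apply: ge_inf; last by exists v.
by exists 0 => _ [u _ <-].
Qed.

Lemma quotient_norm_adherent (q : Q) (e : R) : 0 < e ->
  exists2 v, \pi_Q v = q & `|v| < quotient_norm q + e.
Proof.
move=> e0; have [|_ [v vq <-] ve] := @inf_adherent R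
    [set `|v| | v in [set v | \pi_Q v = q]] _ e0; last by exists v.
split; first by exists `|repr q|, (repr q) => //=; rewrite reprK.
by exists 0 => _ [u _ <-].
Qed.

Lemma quotient_norm_ge0 (q : Q) : 0 <= quotient_norm q.
Proof.
apply/ler_addgt0Pl => e /(quotient_norm_adherent q)[v _ /ltW].
by rewrite addrC; apply: le_trans.
Qed.

Let normD (q r : Q) :
  quotient_norm (q + r) <= quotient_norm q + quotient_norm r.
Proof.
apply/ler_addgt0Pl => e e0; have e2 : 0 < e / 2 by rewrite divr_gt0.
have [u uq ue] := quotient_norm_adherent q e2.
have [v vr ve] := quotient_norm_adherent r e2.
rewrite -{1}uq -{1}vr -pi_quotientD (le_trans (quotient_norm_le _))//.
rewrite (le_trans (ler_normD _ _))// (le_trans (lerD (ltW ue) (ltW ve)))//.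
by rewrite addrACA -splitr addrC.
Qed.

Let normZ_le a (q : Q) : quotient_norm (a *: q) <= `|a| * quotient_norm q.
Proof.
apply/ler_addgt0Pl => e e0.
have e1 : 0 < e / (`|a| + 1) by rewrite divr_gt0// ltr_wpDl.
have [u uq ue] := quotient_norm_adherent q e1.
rewrite -{1}uq -[_ *: _]pi_quotientZ (le_trans (quotient_norm_le _))//.
rewrite normrZ (le_trans (ler_wpM2l (normr_ge0 a) (ltW ue)))//.
rewrite mulrDr addrC lerD2r mulrCA ler_piMr ?(ltW e0)//.
by rewrite ler_pdivrMr ?ltr_wpDl// mul1r lerDl.
Qed.

Let normZ a (q : Q) : quotient_norm (a *: q) = `|a| * quotient_norm q.
Proof.
apply/eqP; rewrite eq_le normZ_le/=.
have [->|a0] := eqVneq a 0.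
  by rewrite normr0 mul0r quotient_norm_ge0.
rewrite -ler_pdivlMl ?normr_gt0// -normfV.
by rewrite (le_trans _ (normZ_le _ _))// scalerK.
Qed.

Let norm0_eq0 (q : Q) : quotient_norm q = 0 -> q = 0.
Proof.
move=> q0; have [v vq] : exists v, \pi_Q v = q by exists (repr q); exact: reprK.
have -> : 0 = \pi_Q 0.
  by apply: (@addrI _ (\pi_Q 0)); rewrite -pi_quotientD !addr0.
rewrite -vq; apply/quotient_eqP; rewrite subr0.
apply: (@closedSubspace_closed _ _ Y) => B /nbhs_ballP[e /= e0 veB].
have [u uq] := quotient_norm_adherent q e0; rewrite q0 add0r => ue.
exists (v - u); split; first by apply/quotient_eqP; rewrite vq.
by apply: veB; rewrite -ball_normE /= opprB addrCA subrr addr0.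
Qed.

HB.instance Definition _ := Lmodule_isNormed.Build R Q normD normZ norm0_eq0.

End quotient_normed.

(* Measurable functions on the whole line with the measure restricted to
   [0, 1]: a.e. classes only depend on the values on [0, 1]. *)
Definition L1 (R : realType) : normedModType R :=
  LspaceType1 (mrestr (@lebesgue_measure R) (measurable_itv `[0%R, 1%R])).

Section operators.
Context (R : realType).
Implicit Types V W : normedModType R.

(* Only meaningful for bounded T: sup is 0 on unbounded sets. *)
Definition operator_norm V W (T : V -> W) : R :=
  sup [set `|T x| | x in [set x | `|x| <= 1]].

Definition rank1 V W (T : {linear V -> W}) : Prop :=
  exists2 w : W, w != 0 & range T = range (fun a : R => a *: w).

Definition daugavet_property V : Prop :=
  forall T : {linear V -> V}, bounded_fun_norm T -> rank1 T ->
    operator_norm (idfun \+ T) = 1 + operator_norm T.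

(* W is linearly homeomorphic to Z with the topology induced by V; S is the
   inverse of T on Z, and its values outside Z are irrelevant. *)
Definition isomorphic_to_subspace W V (Z : closedSubspace V) : Prop :=
  exists (T : {linear W -> V}) (S : V -> W),
    [/\ forall w, T w \in Z, cancel T S, {in Z, cancel S T},
        continuous T & {within [set z | z \in Z], continuous S}].

End operators.

(* Main.v *)
Require Import Defs.
From HB Require Import structures.
From mathcomp Require Import all_boot all_order all_algebra.
From mathcomp Require Import all_classical all_reals all_analysis.
From mathcomp Require Import measurable_realfun hoelder.
From mathcomp Require Import ring lra.
Import Order.TTheory GRing.Theory Num.Theory.
Import numFieldNormedType.Exports.
Local Open Scope classical_set_scope.
Local Open Scope ring_scope.

(** Let I_n be a partition of [0, 1] into sets of positive measure and u_n a
    dense sequence in the unit ball of a separable Banach space X.  Mapping f to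
    the sum of the vectors (integral of f over I_n) u_n makes X a quotient of
    L1.  So it is enough to find a separable Daugavet space X that contains no
    copy of L1, and to know X through a norm on a dense subspace of countable
    dimension ([quotient_model]).

    That subspace is here {poly R}, read as the finitely supported sequences,
    with the norm [poly_norm], the supremum over an explicit set of functionals.
    It is an increasing union of finite-dimensional spaces E_n.  Stage n selects
    a vector y of the unit ball of E_n and adjoins many vectors z_j of norm 1 so
    that

    - the mean of the z_j is close to y ([poly_norm_node_mean]);
    - |x + z_j| >= |x| + 1 for x in E_n ([poly_norm_add_new]);
    - each v in E_(n+1) is the sum of some e in E_n and some f such that
      |u + f| >= |u| + |f| / 2 for all u in E_n ([poly_norm_split]).

    The y run infinitely often through a dense subset of the unit ball, so by the
    first two properties the vectors that are l1-orthogonal to a given x have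
    the whole ball as their closed convex hull; this gives the Daugavet property
    ([daugavet_of_means]).

    The third property excludes L1.  Iterating it, v becomes a sum of pieces,
    each of them l1-orthogonal up to the factor 2 to the preceding ones.  Given a
    bounded sequence whose terms are c apart, pass to a limit of the pieces along
    an ultrafilter: up to a small error, infinitely many terms consist of a
    common part and of pieces of arbitrarily high index.  Differences of such
    terms add up as in l1, so that for every M some sum of M differences of
    distinct terms has norm at least M c / 4 ([separated_l1_sums]).  In L1 the
    functions cos((m + 1) pi x) are separated, but being orthogonal they have
    signed sums of M terms whose norm is of the order of the square root of M
    ([L1_wave_sums]).  This contradiction is carried through an isomorphism in
    [no_L1_copy].

    The first and the third property pull in opposite directions.  If the z_j
    spanned l1 modulo the relation that y is their mean, iteration would produce
    copies of L1, and the means of half of the z_j would violate the third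
    property.  If there were a single scale N, so that combinations of fewer
    than N of the z_j behave as in l1 and flat combinations of more than N
    of them as multiples of y, then combinations of about N of them would
    violate it.  Following an idea of Bourgain and Rosenthal, the norming
    functionals average over many scales, and a vector can be in the bad range
    of a small proportion of them only; see the definition [stage]. *)

Set Implicit Arguments.
Unset Strict Implicit.
Unset Printing Implicit Defensive.

(** * Finitely supported sequences and the functionals on them *)

Section pairing.
Context (R : realType).
Implicit Types (phi : nat -> R) (v : {poly R}) (d n : nat).

(** Sequences with finite support are encoded as polynomials, so that a
    functional is the sequence of its values on the basis vectors 'X^j. *)
Definition pairing phi v : R := \sum_(j < size v) v`_j * phi j.

Lemma pairing_widen n phi v : (size v <= n)%N ->
  pairing phi v = \sum_(j < n) v`_j * phi j.
Proof.
move=> vn; rewrite /pairing (big_ord_widen n (fun j => v`_j * phi j) vn).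
rewrite big_mkcond; apply: eq_bigr => j _; case: ltnP => // jv.
by rewrite nth_default// mul0r.
Qed.

Lemma pairingD phi u v : pairing phi (u + v) = pairing phi u + pairing phi v.
Proof.
pose n := maxn (size u) (size v).
rewrite (@pairing_widen n phi u) ?leq_maxl// (@pairing_widen n phi v) ?leq_maxr//.
rewrite (@pairing_widen n) ?size_polyD// -big_split/=.
by apply: eq_bigr => j _; rewrite coefD mulrDl.
Qed.

Lemma pairingZ phi c v : pairing phi (c *: v) = c * pairing phi v.
Proof.
rewrite (@pairing_widen (size v)) ?size_scale_leq// mulr_sumr.
by apply: eq_bigr => j _; rewrite coefZ mulrA.
Qed.

Lemma pairing0 phi : pairing phi 0 = 0.
Proof. by rewrite -(scale0r 0) pairingZ mul0r. Qed.

Lemma pairingN phi v : pairing phi (- v) = - pairing phi v.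
Proof. by rewrite -scaleN1r pairingZ mulN1r. Qed.

Lemma pairingB phi u v : pairing phi (u - v) = pairing phi u - pairing phi v.
Proof. by rewrite pairingD pairingN. Qed.

Lemma pairing_sum phi (I : Type) (r : seq I) (F : I -> {poly R}) :
  pairing phi (\sum_(i <- r) F i) = \sum_(i <- r) pairing phi (F i).
Proof. by apply: big_morph; [exact: pairingD|exact: pairing0]. Qed.

Lemma pairingXn phi j : pairing phi 'X^j = phi j.
Proof.
rewrite (@pairing_widen j.+1) ?size_polyXn// big_ord_recr/= coefXn eqxx mul1r.
rewrite big1 ?add0r// => i _.
by rewrite coefXn (ltn_eqF (ltn_ord i)) mul0r.
Qed.

Lemma pairingNl phi v : pairing (fun j => - phi j) v = - pairing phi v.
Proof. by rewrite -sumrN; apply: eq_bigr => j _; rewrite mulrN. Qed.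

Lemma eq_pairing d phi psi v : (size v <= d)%N ->
  (forall j, (j < d)%N -> phi j = psi j) -> pairing phi v = pairing psi v.
Proof.
move=> vd e; apply: eq_bigr => j _; rewrite e//.
exact: leq_trans (ltn_ord j) vd.
Qed.

Lemma pairing_split d k phi v : (size v <= d + k)%N ->
  pairing phi v = pairing phi (take_poly d v) +
    \sum_(j < k) v`_(d + j) * phi (d + j)%N.
Proof.
move=> vd; rewrite (pairing_widen _ vd) big_split_ord/=; congr (_ + _).
rewrite (@pairing_widen d) ?size_take_poly//; apply: eq_bigr => j _.
by rewrite coef_take_poly ltn_ord.
Qed.

End pairing.

Section construction.
Context (R : realType).
Implicit Types (phi psi : nat -> R) (v : {poly R}) (d n : nat) (t : R).

(** The number of scales used at stage n, and also the ratio of two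
    consecutive scales.  With the factor 5 one has
    weight n = 3 / levels n + 2 / levels n, the two error terms that appear in
    [concentrated_half]. *)
Definition levels n := (5 * n.+1)%N.
Definition weight n : R := n.+1%:R^-1.
(** The number of vectors adjoined at stage n, chosen so large that the
    coarsest scale, levels n ^ levels n, is only the fraction weight n of
    it. *)
Definition width n := (n.+1 * levels n ^ levels n)%N.
Definition dimen n := (\sum_(m < n) width m)%N.

(** The admissible values p j of a functional on the vectors adjoined at
    stage n, when its value on the vector y to be approximated is t.  Each p j
    averages, over the scales i, numbers psi i j that may leave t only on about
    levels n ^ i.+1 indices.  At scale i a combination of few new vectors is
    thus normed as in l1, and a combination of many of them with small
    coefficients as a multiple of y; only coefficients whose size is close to
    the scale are seen otherwise, and a given coefficient is close to one
    scale at most.  The unconstrained term chi, of small weight, bounds the l1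
    norm of the coefficients and so makes the effect of that one scale
    negligible. *)
Definition stage n t (p : nat -> R) : Prop :=
  exists (chi : nat -> R) (psi : nat -> nat -> R),
    [/\ forall j, `|chi j| <= 1, forall i j, `|psi i j| <= 1,
        forall i, (i < levels n)%N ->
          \sum_(j < width n) `|psi i j - t| <= (levels n ^ i.+1)%:R
      & forall j, (j < width n)%N ->
          p j = weight n * chi j +
            (1 - weight n) / (levels n)%:R * \sum_(i < levels n) psi i j].

(** The first component of the pair is a dummy: it makes every rational
    polynomial appear at infinitely many indices. *)
Definition candidate n : {poly R} :=
  if unpickle n is Some mq then map_poly ratr (mq : nat * {poly rat}).2 else 0.

(** The candidate is approximated at stage n only if it lies in the unit ball
    of the space built so far, since functionals have to take values in [-1, 1]
    on it. *)
Definition target n (A : set (nat -> R)) : {poly R} :=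
  if `[< (size (candidate n) <= dimen n)%N /\
         forall phi, A phi -> pairing phi (candidate n) <= 1 >]
  then candidate n else 0.

(** The dual unit ball after n stages.  It constrains only the coordinates
    below dimen n ([dual_local]).  The recursion carries the set itself because
    the vector treated at stage n depends on the norm defined by the previous
    stages. *)
Fixpoint dual n : set (nat -> R) :=
  if n is m.+1 then
    [set phi | dual m phi /\
       stage m (pairing phi (target m (dual m))) (fun j => phi (dimen m + j)%N)]
  else setT.

Definition node n := target n (dual n).

Lemma levels_gt0 n : (0 < levels n)%N. Proof. by []. Qed.

Lemma levels_gt1 n : (1 < levels n)%N. Proof. by rewrite /levels mulnS. Qed.

Lemma width_gt0 n : (0 < width n)%N.
Proof. by rewrite muln_gt0 expn_gt0. Qed.

Lemma weight_gt0 n : 0 < weight n. Proof. by rewrite invr_gt0. Qed.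

Lemma weight_le1 n : weight n <= 1.
Proof. by rewrite invf_le1 ?ler1n. Qed.

Lemma weight_levels n : weight n = 5 / (levels n)%:R.
Proof.
by rewrite /weight /levels natrM invfM mulrA mulfV ?mul1r// pnatr_eq0.
Qed.

Lemma dimenS n : dimen n.+1 = (dimen n + width n)%N.
Proof. by rewrite /dimen big_ord_recr. Qed.

Lemma leq_dimen m n : (m <= n)%N -> (dimen m <= dimen n)%N.
Proof.
move=> /subnK <-; elim: (n - m)%N => // k IH.
by rewrite addSn dimenS (leq_trans IH)// leq_addr.
Qed.

Lemma dimen_ge n : (n <= dimen n)%N.
Proof.
elim: n => // n IH; rewrite dimenS -addn1 leq_add//.
exact: width_gt0.
Qed.

Lemma size_node n : (size (node n) <= dimen n)%N.
Proof.
rewrite /node /target; case: asboolP => [[]//|_].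
by rewrite size_poly0.
Qed.

Lemma stageN n t p : stage n t p -> stage n (- t) (fun j => - p j).
Proof.
move=> [chi [psi [chi1 psi1 cap pE]]].
exists (fun j => - chi j), (fun i j => - psi i j); split => [j|i j|i il|j jk].
- by rewrite normrN.
- by rewrite normrN.
- rewrite (le_trans _ (cap _ il))// ler_sum// => j _.
  by rewrite -opprD normrN.
- by rewrite pE// sumrN opprD !mulrN.
Qed.

Lemma stage_const n t : `|t| <= 1 -> stage n t (fun=> t).
Proof.
move=> t1; exists (fun=> t), (fun _ _ => t); split=> // [i il|j jk].
  by rewrite big1 ?ler0n// => j _; rewrite subrr normr0.
rewrite sumr_const card_ord -[t *+ _]mulr_natl.
have : (levels n)%:R != 0 :> R by rewrite pnatr_eq0 -lt0n levels_gt0.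
by move=> ?; field.
Qed.

Lemma stage_norm_le1 n t p j : stage n t p -> (j < width n)%N -> `|p j| <= 1.
Proof.
move=> [chi [psi [chi1 psi1 cap pE]]] jk; rewrite pE//.
have w0 := weight_gt0 n; have w1 := weight_le1 n.
have l0 : 0 < (levels n)%:R :> R by rewrite ltr0n levels_gt0.
have g0 : 0 <= (1 - weight n) / (levels n)%:R.
  by rewrite divr_ge0 ?subr_ge0// ltW.
rewrite (le_trans (ler_normD _ _))// (normrM (weight n)) (normrM (_ / _)).
rewrite (ger0_norm g0) (gtr0_norm w0).
have : `|\sum_(i < levels n) psi i j| <= (levels n)%:R.
  rewrite (le_trans (ler_norm_sum _ _ _))//.
  rewrite (le_trans (ler_sum _ (fun (i : 'I_(levels n)) _ => psi1 i j)))//.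
  by rewrite sumr_const card_ord.
move=> /(ler_wpM2l g0); rewrite divfK ?gt_eqF// => h.
have := ler_wpM2l (ltW w0) (chi1 j); lra.
Qed.

Lemma dual_local n phi psi : (forall j, (j < dimen n)%N -> phi j = psi j) ->
  dual n phi -> dual n psi.
Proof.
elim: n phi psi => // n IH phi psi e [/= Dphi [chi [f [c1 f1 cap pE]]]].
have e' j : (j < dimen n)%N -> phi j = psi j.
  by move=> jn; apply: e; rewrite (leq_trans jn)// dimenS leq_addr.
split; first exact: IH Dphi.
exists chi, f; split => //; last first.
  by move=> j jk; rewrite -pE// e// dimenS ltn_add2l.
by rewrite -(eq_pairing (size_node n) e').
Qed.

Lemma dualN n phi : dual n phi -> dual n (fun j => - phi j).
Proof.
elim: n phi => // n IH phi [/= /IH Dphi /stageN St]; split=> //.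
by rewrite pairingNl.
Qed.

Lemma dual0 n : dual n (fun=> 0).
Proof.
elim: n => // n IH; split=> //=.
rewrite [pairing _ _]big1; last by move=> j _; rewrite mulr0.
by apply: stage_const; rewrite normr0.
Qed.

Lemma dualS n phi : dual n.+1 phi -> dual n phi. Proof. by case. Qed.

Lemma dual_stage n phi : dual n.+1 phi ->
  stage n (pairing phi (node n)) (fun j => phi (dimen n + j)%N).
Proof. by case. Qed.

Lemma pairing_node n phi : dual n phi -> `|pairing phi (node n)| <= 1.
Proof.
move=> Dphi; rewrite /node /target; case: asboolP => [[_ h]|_].
  rewrite ler_norml h// andbT lerNl -pairingNl.
  by apply: h; exact: dualN.
by rewrite pairing0 normr0.
Qed.

Lemma dual_norm_le1 n phi j : dual n phi -> (j < dimen n)%N -> `|phi j| <= 1.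
Proof.
elim: n phi j => [phi j _|n IH phi j [/= D S] jd]; first by rewrite /dimen big_ord0.
have [jn|nj] := ltnP j (dimen n); first exact: IH.
rewrite -(subnKC nj); apply: (stage_norm_le1 S).
by rewrite ltn_subLR// -dimenS.
Qed.

(** The new coordinates of a functional are free within their stage: this
    makes each norm below a norm extending the previous one, and it is the
    source of all lower estimates. *)
Lemma dual_extend n phi p : dual n phi -> stage n (pairing phi (node n)) p ->
  exists psi, [/\ dual n.+1 psi, forall j, (j < dimen n)%N -> psi j = phi j
    & forall j, psi (dimen n + j)%N = p j].
Proof.
move=> Dphi Sp; pose psi j := if (j < dimen n)%N then phi j else p (j - dimen n)%N.
have psiE j : (j < dimen n)%N -> psi j = phi j by rewrite /psi => ->.
have psip j : psi (dimen n + j)%N = p j.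
  by rewrite /psi ltnNge leq_addr/= addKn.
exists psi; split => //; split.
  by apply: dual_local Dphi => j jn; rewrite psiE.
have -> : pairing psi (target n (dual n)) = pairing phi (node n).
  exact: eq_pairing (size_node n) psiE.
case: Sp => chi [f [c1 f1 cap pE]]; exists chi, f; split=> // j jk.
by rewrite psip pE.
Qed.

Definition level_norm n v : R := sup [set pairing phi v | phi in dual n].

Definition poly_norm v : R := level_norm (size v) v.

Lemma pairing_le_sum n phi v : (size v <= dimen n)%N -> dual n phi ->
  `|pairing phi v| <= \sum_(j < size v) `|v`_j|.
Proof.
move=> vn Dphi; rewrite (le_trans (ler_norm_sum _ _ _))// ler_sum// => j _.
rewrite normrM ler_piMr// (dual_norm_le1 Dphi)//.
exact: leq_trans (ltn_ord j) vn.
Qed.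

Lemma has_sup_level n v : (size v <= dimen n)%N ->
  has_sup [set pairing phi v | phi in dual n].
Proof.
move=> vn; split; first by exists (pairing (fun=> 0) v), (fun=> 0) => //; exact: dual0.
exists (\sum_(j < size v) `|v`_j|) => _ [phi Dphi <-].
by rewrite (le_trans (ler_norm _))// (pairing_le_sum vn).
Qed.

(** Any functional extends by the constant value t on the new vectors, so both
    suprema run over the same set of values. *)
Lemma level_normS n v : (size v <= dimen n)%N ->
  level_norm n.+1 v = level_norm n v.
Proof.
move=> vn; congr sup; apply/seteqP; split=> _ [phi Dphi <-].
  by exists phi => //; exact: dualS.
have [psi [Dpsi e _]] := dual_extend Dphi (stage_const n (pairing_node Dphi)).
by exists psi => //; exact: eq_pairing vn e.
Qed.

Lemma poly_normE n v : (size v <= dimen n)%N -> poly_norm v = level_norm n v.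
Proof.
suff key m k : (size v <= dimen m)%N -> level_norm (m + k)%N v = level_norm m v.
  move=> vn; rewrite /poly_norm -(key _ n) ?dimen_ge// addnC key//.
move=> vm; elim: k => [|k IH]; first by rewrite addn0.
by rewrite addnS level_normS// (leq_trans vm)// leq_dimen// leq_addr.
Qed.

Lemma pairing_le_norm n phi v : (size v <= dimen n)%N -> dual n phi ->
  pairing phi v <= poly_norm v.
Proof.
move=> vn Dphi; rewrite (poly_normE vn); apply: sup_upper_bound; last by exists phi.
exact: has_sup_level.
Qed.

Lemma poly_norm_le n v c : (size v <= dimen n)%N ->
  (forall phi, dual n phi -> pairing phi v <= c) -> poly_norm v <= c.
Proof.
move=> vn h; rewrite (poly_normE vn); apply: ge_sup; first by case: (has_sup_level vn).
by move=> _ [phi Dphi <-]; exact: h.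
Qed.

Lemma poly_norm_adherent n v e : (size v <= dimen n)%N -> 0 < e ->
  exists2 phi, dual n phi & poly_norm v - e < pairing phi v.
Proof.
move=> vn e0; have [_ [phi Dphi <-]] := sup_adherent e0 (has_sup_level vn).
by rewrite -/(level_norm n v) -(poly_normE vn) => h; exists phi.
Qed.

Lemma poly_norm_ge0 v : 0 <= poly_norm v.
Proof.
have := @pairing_le_norm (size v) (fun=> 0) v (dimen_ge _) (dual0 _).
by rewrite [pairing _ _]big1// => j _; rewrite mulr0.
Qed.

Lemma poly_normD u v : poly_norm (u + v) <= poly_norm u + poly_norm v.
Proof.
pose n := maxn (size u) (size v).
have un : (size u <= dimen n)%N by rewrite (leq_trans (leq_maxl _ (size v)))// dimen_ge.
have vn : (size v <= dimen n)%N by rewrite (leq_trans (leq_maxr (size u) _))// dimen_ge.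
apply: (@poly_norm_le n) => [|phi Dphi].
  by rewrite (leq_trans (size_polyD _ _))// geq_max un.
by rewrite pairingD lerD// (@pairing_le_norm n).
Qed.

Lemma poly_normN v : poly_norm (- v) = poly_norm v.
Proof.
suff h u : poly_norm (- u) <= poly_norm u.
  by apply/eqP; rewrite eq_le h -{1}(opprK v) h.
have un := dimen_ge (size u).
apply: (@poly_norm_le (size u)) => [|phi Dphi]; first by rewrite size_polyN.
rewrite pairingN -pairingNl; apply: (@pairing_le_norm (size u)) => //.
exact: dualN.
Qed.

Lemma poly_normZ c v : poly_norm (c *: v) = `|c| * poly_norm v.
Proof.
suff h a u : 0 < a -> poly_norm (a *: u) <= a * poly_norm u.
  have h' a u : 0 < a -> poly_norm (a *: u) = a * poly_norm u.
    move=> a0; apply/eqP; rewrite eq_le h//= -ler_pdivlMl//.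
    by rewrite (le_trans _ (h _ _ _)) ?invr_gt0// scalerA mulVf ?gt_eqF// scale1r.
  have [c0|c0|<-] := ltgtP 0 c.
  - by rewrite h'// gtr0_norm.
  - by rewrite -poly_normN -scaleNr h' ?oppr_gt0// ltr0_norm.
  - rewrite scale0r normr0 mul0r; apply/eqP; rewrite eq_le poly_norm_ge0 andbT.
    by apply: (@poly_norm_le 0%N) => [|phi _]; rewrite ?size_poly0 ?pairing0.
move=> a0; have un := dimen_ge (size u).
apply: (@poly_norm_le (size u)) => [|phi Dphi].
  by rewrite (leq_trans (size_scale_leq _ _)).
by rewrite pairingZ ler_pM2l// (@pairing_le_norm (size u)).
Qed.

Lemma poly_norm0 : poly_norm 0 = 0.
Proof. by rewrite -(scale0r 0) poly_normZ normr0 mul0r. Qed.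

Lemma poly_normB u v : poly_norm (u - v) = poly_norm (v - u).
Proof. by rewrite -poly_normN opprB. Qed.

Lemma poly_norm_sum (I : Type) (r : seq I) (F : I -> {poly R}) :
  poly_norm (\sum_(i <- r) F i) <= \sum_(i <- r) poly_norm (F i).
Proof.
elim: r => [|i r IH]; first by rewrite !big_nil poly_norm0.
by rewrite !big_cons (le_trans (poly_normD _ _))// lerD2l.
Qed.

Lemma poly_norm_Xn_le1 j : poly_norm 'X^j <= 1.
Proof.
have jn := dimen_ge j.+1.
apply: (@poly_norm_le j.+1) => [|phi Dphi]; first by rewrite size_polyXn.
by rewrite pairingXn (le_trans (ler_norm _))// (dual_norm_le1 Dphi).
Qed.

End construction.

(** * The vectors adjoined at one stage *)

Section stage_geometry.
Context (R : realType).
Implicit Types (phi psi : nat -> R) (v : {poly R}) (d n : nat) (t : R).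
Local Notation weight := (@weight R).
Local Notation node := (@node R).
Local Notation dual := (@dual R).

(** The weight of one scale. *)
Definition share n : R := (1 - weight n) / (levels n)%:R.

Lemma share_ge0 n : 0 <= share n.
Proof. by rewrite divr_ge0 ?subr_ge0 ?weight_le1. Qed.

Lemma share_levels n : share n * (levels n)%:R = 1 - weight n.
Proof. by rewrite divfK// pnatr_eq0 -lt0n levels_gt0. Qed.

Lemma cap_le_width n i : (i < levels n)%N ->
  (levels n ^ i.+1)%:R <= weight n * (width n)%:R :> R.
Proof.
move=> il; rewrite natrM mulrA mulVf ?pnatr_eq0// mul1r ler_nat.
by rewrite leq_exp2l ?levels_gt1.
Qed.

(** At scale i the numbers psi i j differ from t by at most
    levels n ^ i.+1 in total, which is small after division by width n; only the
    term chi, of weight weight n, contributes the rest. *)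
Lemma poly_norm_node_mean n :
  poly_norm (node n - (width n)%:R^-1 *: \sum_(j < width n) 'X^(dimen n + j))
    <= 3 * weight n.
Proof.
have k0 : 0 < (width n)%:R :> R by rewrite ltr0n width_gt0.
have w0 := weight_gt0 R n; have g0 := share_ge0 n.
apply: (@poly_norm_le _ n.+1) => [|phi Dphi].
  rewrite (leq_trans (size_polyD _ _))// geq_max size_polyN dimenS.
  rewrite (leq_trans (size_node R n)) ?leq_addr//=.
  rewrite (leq_trans (size_scale_leq _ _))//.
  rewrite (leq_trans (size_sum _ _ _))//; apply/bigmax_leqP => j _.
  by rewrite size_polyXn -addnS leq_add2l.
have t1 := pairing_node (dualS Dphi).
have [chi [psi [chi1 psi1 cap pE]]] := dual_stage Dphi.
rewrite pairingB pairingZ pairing_sum; set t := pairing phi (node n) in t1 cap *.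
rewrite -(ler_pM2l k0) mulrBr mulVKf ?gt_eqF//.
have -> : (width n)%:R * t - \sum_(j < width n) pairing phi 'X^(dimen n + j) =
    \sum_(j < width n) (weight n * (t - chi j) +
      share n * \sum_(i < levels n) (t - psi i j)).
  have -> : (width n)%:R * t = \sum_(j < width n) t.
    by rewrite sumr_const card_ord mulr_natl.
  rewrite -sumrB; apply: eq_bigr => j _; rewrite pairingXn pE// -/(share n).
  rewrite sumrB sumr_const card_ord -[t *+ _]mulr_natl !mulrBr mulrA share_levels.
  by rewrite mulrBl mul1r; ring.
have -> : (width n)%:R * (3 * weight n) =
   (width n)%:R * (2 * weight n) + 1 * (weight n * (width n)%:R) by ring.
rewrite big_split/= lerD//.
  apply: (@le_trans _ _ (\sum_(j < width n) (2 * weight n))); last first.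
    by rewrite sumr_const card_ord -[leLHS]mulr_natl.
  rewrite ler_sum// => j _; rewrite mulrC ler_pM2r//.
  have := chi1 j; rewrite !ler_norml in t1 *; lra.
rewrite -mulr_sumr exchange_big/=.
apply: (@le_trans _ _ (share n * \sum_(i < levels n) (weight n * (width n)%:R))).
  rewrite ler_wpM2l// ler_sum// => i _.
  rewrite (le_trans _ (cap_le_width (ltn_ord i)))// (le_trans _ (cap _ (ltn_ord i)))//.
  by rewrite ler_sum// => j _; rewrite distrC ler_norm.
rewrite sumr_const card_ord -[_ *+ _]mulr_natl mulrA share_levels.
by apply: ler_wpM2r; [rewrite mulr_ge0// ltW|rewrite gerBl ltW].
Qed.

(** A functional almost norming v may be given the value 1 on a single new
    vector: changing one index is allowed at every scale. *)
Lemma poly_norm_add_new n v j : (size v <= dimen n)%N -> (j < width n)%N ->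
  poly_norm v + 1 <= poly_norm (v + 'X^(dimen n + j)).
Proof.
move=> vn jk; apply/ler_addgt0Pr => e e0.
have [phi Dphi he] := poly_norm_adherent vn e0.
have t1 := pairing_node Dphi; set t := pairing phi (node n) in t1.
pose q l : R := if l == j then 1 else t.
have q1 l : `|q l| <= 1 by rewrite /q; case: ifP; rewrite ?normr1.
have Sq : stage n t q.
  exists q, (fun=> q); split=> // [i il|l lk].
    rewrite (bigD1 (Ordinal jk))//= /q eqxx big1 ?addr0; last first.
      by move=> l; rewrite -val_eqE/= => /negPf ->; rewrite subrr normr0.
    apply: (@le_trans _ _ 2); first by rewrite !ler_norml in t1 *; lra.
    rewrite ler_nat (@leq_trans (levels n)) ?levels_gt1// -[X in (X <= _)%N]expn1.
    by rewrite leq_exp2l ?levels_gt1.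
  rewrite sumr_const card_ord -[q l *+ _]mulr_natl mulrA -/(share n) share_levels.
  by ring.
have [psi [Dpsi ephi ep]] := dual_extend Dphi Sq.
have sz : (size (v + 'X^(dimen n + j) : {poly R})%R <= dimen n.+1)%N.
  rewrite (leq_trans (size_polyD _ _))// geq_max size_polyXn dimenS -addnS leq_add2l jk.
  by rewrite (leq_trans vn)// leq_addr.
have := pairing_le_norm sz Dpsi; rewrite pairingD pairingXn ep /q eqxx.
rewrite (eq_pairing vn ephi); lra.
Qed.

(** Only the term chi is used here, with the signs of the coefficients, over
    the zero functional. *)
Lemma coef_le_norm_step n v : (size v <= dimen n.+1)%N ->
  weight n * \sum_(j < width n) `|v`_(dimen n + j)| <= poly_norm v.
Proof.
move=> vn; pose p j : R := weight n * Num.sg v`_(dimen n + j).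
have sg1 (x : R) : `|Num.sg x| <= 1 by rewrite normr_sg lern1 leq_b1.
have Sp : stage n (pairing (fun=> 0) (node n)) p.
  rewrite [pairing _ _]big1; last by move=> j _; rewrite mulr0.
  exists (fun j => Num.sg v`_(dimen n + j)), (fun _ _ => 0); split=> //.
  - by move=> *; rewrite normr0.
  - by move=> i il; rewrite big1 ?ler0n// => j _; rewrite subr0 normr0.
  - by move=> j jk; rewrite big1// mulr0 addr0.
have [phi [Dphi phi0 phip]] := dual_extend (dual0 _ n) Sp.
rewrite (le_trans _ (pairing_le_norm vn Dphi))//.
rewrite (@pairing_split _ (dimen n) (width n)) -?dimenS//.
rewrite (@eq_pairing _ (dimen n) _ (fun=> 0)) ?size_take_poly//.
rewrite [pairing _ _]big1 ?add0r; last by move=> j _; rewrite mulr0.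
rewrite mulr_sumr ler_sum// => j _; rewrite phip /p normrEsg; lra.
Qed.

(** Bounded sequences of polynomials of bounded size therefore have limits
    along ultrafilters, see [ultralimit_poly]. *)
Lemma coef_le_norm n : exists2 C : R, 0 <= C &
  forall v j, (size v <= dimen n)%N -> `|v`_j| <= C * poly_norm v.
Proof.
elim: n => [|n [C C0 IH]].
  exists 0 => // v j; rewrite /dimen big_ord0 leqn0 size_poly_eq0 => /eqP ->.
  by rewrite coef0 normr0 mul0r.
have w0 := weight_gt0 R n.
exists (C * (1 + (weight n)^-1) + (weight n)^-1).
  by rewrite addr_ge0 ?mulr_ge0 ?addr_ge0// invr_ge0 ltW.
move=> v j vn; set A := \sum_(j < width n) `|v`_(dimen n + j)|.
have A0 : 0 <= A by apply: sumr_ge0.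
have hA : A <= (weight n)^-1 * poly_norm v.
  by rewrite ler_pdivlMl// coef_le_norm_step.
have hv : poly_norm (take_poly (dimen n) v) <= poly_norm v + A.
  apply: (@poly_norm_le _ n.+1) => [|phi Dphi].
    by rewrite (leq_trans (size_take_poly _ _))// leq_dimen.
  have vn' := vn; rewrite dimenS in vn'.
  have := pairing_le_norm vn Dphi; rewrite (pairing_split _ vn').
  suff : `|\sum_(j < width n) v`_(dimen n + j) * phi (dimen n + j)%N| <= A.
    by rewrite ler_norml; lra.
  rewrite (le_trans (ler_norm_sum _ _ _))// ler_sum// => l _.
  rewrite normrM ler_piMr// (dual_norm_le1 Dphi)//.
  by rewrite dimenS ltn_add2l.
have P0 := poly_norm_ge0 v.
have [jn|nj] := ltnP j (dimen n).
  have := IH _ j (size_take_poly (dimen n) v); rewrite coef_take_poly jn.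
  move=> /le_trans; apply; apply: (@le_trans _ _ (C * (poly_norm v + (weight n)^-1 * poly_norm v))).
    by rewrite ler_wpM2l// (le_trans hv)// lerD2l.
  have : 0 <= (weight n)^-1 * poly_norm v by rewrite mulr_ge0// invr_ge0 ltW.
  by lra.
have : `|v`_j| <= A.
  have [jk|kj] := ltnP (j - dimen n) (width n); last first.
    rewrite nth_default ?normr0// (leq_trans vn)// dimenS.
    by rewrite -(subnKC nj) leq_add2l.
  rewrite /A (bigD1 (Ordinal jk))//= subnKC// lerDl.
  by apply: sumr_ge0.
move=> /le_trans/(_ hA)/le_trans; apply.
by rewrite ler_wpM2r// lerDr mulr_ge0// addr_ge0// invr_ge0 ltW.
Qed.

End stage_geometry.

(** * Splitting off an l1-orthogonal part *)

Section stage_splitting.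
Context (R : realType) (n : nat) (a : nat -> R).
Local Notation weight := (@weight R).
Local Notation share := (@share R).

Let A := \sum_(j < width n) `|a j|.

(** The coefficients too large for scale i to average them out.  The others
    are split further by [big_at] at i.+1: those not big at i.+1 are small
    enough to be flat at scale i. *)
Definition big_at i j : bool := 2 * A < `|a j| * (levels n ^ i.+1)%:R.

Definition big_mass i : R := \sum_(j < width n | big_at i j) `|a j|.

(** The multiple of y that the combination of the new vectors with
    coefficients a looks like, averaged over the scales. *)
Definition flat_mass : R :=
  share n * \sum_(i < levels n) \sum_(j < width n | ~~ big_at i.+1 j) a j.

Let A0 : 0 <= A. Proof. exact: sumr_ge0. Qed.

Let N0 i : 0 < (levels n ^ i)%:R :> R.
Proof. by rewrite ltr0n expn_gt0 levels_gt0. Qed.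

Lemma big_atS i j : big_at i j -> big_at i.+1 j.
Proof.
move=> /lt_le_trans; apply; apply: ler_wpM2l => //.
by rewrite ler_nat leq_exp2l ?levels_gt1.
Qed.

Lemma big_mass_ge0 i : 0 <= big_mass i. Proof. exact: sumr_ge0. Qed.

Lemma big_mass_le i : big_mass i <= A.
Proof.
rewrite /A (bigID (fun j : 'I_(width n) => big_at i j))/= lerDl.
exact: sumr_ge0.
Qed.

(** A sign pattern on the big coefficients changes psi by at most 2 at each of
    them, and this bound says that such a change is admissible. *)
Lemma card_big i :
  \sum_(j < width n | big_at i j) (2 : R) <= (levels n ^ i.+1)%:R.
Proof.
have [A00|Apos] := eqVneq A 0.
  rewrite big1 ?ltW// => j; rewrite /big_at A00 mulr0.
  suff -> : a j = 0 by rewrite normr0 mul0r ltxx.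
  apply/normr0_eq0/eqP; rewrite eq_le normr_ge0 andbT -A00 /A.
  by rewrite (bigD1 j)//= lerDl sumr_ge0.
have {}Apos : 0 < A by rewrite lt_def Apos A0.
rewrite -(ler_pM2l Apos) mulr_sumr.
apply: (@le_trans _ _ (\sum_(j < width n | big_at i j) `|a j| * (levels n ^ i.+1)%:R)).
  by apply: ler_sum => j /ltW; rewrite mulrC.
by rewrite -mulr_suml ler_pM2r// big_mass_le.
Qed.

(** What an admissible functional can gain at scale i over treating the flat
    coefficients as a multiple of y: the small size of these coefficients
    compensates the total deviation allowed for psi. *)
Lemma flat_part_le i (psi : nat -> R) t : (forall j, `|psi j| <= 1) ->
  \sum_(j < width n) `|psi j - t| <= (levels n ^ i.+1)%:R ->
  \sum_(j < width n) a j * psi j - t * \sum_(j < width n | ~~ big_at i.+1 j) a j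
    <= big_mass i.+1 + 2 * A / (levels n)%:R.
Proof.
move=> psi1 cap; rewrite (bigID (fun j : 'I_(width n) => big_at i.+1 j))/=.
rewrite -addrA mulr_sumr -sumrB lerD//.
  apply: ler_sum => j _; rewrite (le_trans (ler_norm _))// normrM.
  by rewrite ler_piMr.
pose q := 2 * A / (levels n ^ i.+2)%:R.
have q0 : 0 <= q by rewrite divr_ge0// mulr_ge0.
have -> : 2 * A / (levels n)%:R = q * (levels n ^ i.+1)%:R.
  rewrite /q expnS natrM invfM mulrA divfK// gt_eqF//.
apply: le_trans (ler_wpM2l q0 cap).
rewrite mulr_sumr big_mkcond/=; apply: ler_sum => j _.
case: ifPn => [|_]; last by rewrite mulr_ge0.
rewrite /big_at -leNgt -ler_pdivlMr// => small.
rewrite (mulrC t) -mulrBr (le_trans (ler_norm _))// normrM.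
by rewrite ler_wpM2r.
Qed.

(** The functional that takes the signs of the big coefficients and t
    elsewhere.  It loses at scale i only the coefficients that are big at i.+1
    but not at i. *)
Lemma concentrated_stage t : `|t| <= 1 ->
  exists2 p, stage n t p &
    weight n * A + share n * \sum_(i < levels n) (2 * big_mass i - big_mass i.+1)
      <= \sum_(j < width n) a j * p j - t * flat_mass.
Proof.
move=> t1.
have sg1 (x : R) : `|Num.sg x| <= 1 by rewrite normr_sg lern1 leq_b1.
pose psi i j := if big_at i j then Num.sg (a j) else t.
pose p j := weight n * Num.sg (a j) + share n * \sum_(i < levels n) psi i j.
exists p.
  exists (fun j => Num.sg (a j)), psi; split=> [//|i j|i il|//].
    by rewrite /psi; case: ifP.
  apply: le_trans (card_big i); rewrite [leRHS]big_mkcond/=.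
  apply: ler_sum => j _; rewrite /psi; case: ifP => _.
    rewrite (le_trans (ler_normB _ _))//; have := sg1 (a j); lra.
  by rewrite subrr normr0.
have -> : \sum_(j < width n) a j * p j =
    weight n * A + share n * \sum_(i < levels n) \sum_(j < width n) a j * psi i j.
  rewrite exchange_big/= !mulr_sumr -big_split/=; apply: eq_bigr => j _.
  by rewrite /p normrEsg -!mulr_sumr; ring.
rewrite -addrA lerD2l /flat_mass mulrCA -mulrBr ler_wpM2l ?share_ge0//.
rewrite mulr_sumr -sumrB; apply: ler_sum => i _.
have -> : \sum_(j < width n) a j * psi i j = big_mass i +
    t * \sum_(j < width n | ~~ big_at i j) a j.
  rewrite (bigID (fun j : 'I_(width n) => big_at i j))/= mulr_sumr; congr (_ + _).
    by apply: eq_bigr => j h; rewrite /psi h normrEsg mulrC.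
  by apply: eq_bigr => j /negPf h; rewrite /psi h mulrC.
suff : - (big_mass i.+1 - big_mass i) <=
    t * (\sum_(j < width n | ~~ big_at i j) a j -
         \sum_(j < width n | ~~ big_at i.+1 j) a j) by lra.
have -> : big_mass i.+1 - big_mass i =
    \sum_(j < width n | big_at i.+1 j && ~~ big_at i j) `|a j|.
  rewrite /big_mass [X in X - _](bigID (fun j : 'I_(width n) => big_at i j))/=.
  rewrite [X in X + _ - _](eq_bigl (fun j : 'I_(width n) => big_at i j)).
    by rewrite addrAC subrr add0r.
  by move=> j /=; case h : (big_at i j); rewrite ?andbF// (big_atS h).
have -> : \sum_(j < width n | ~~ big_at i j) a j -
         \sum_(j < width n | ~~ big_at i.+1 j) a j =
    \sum_(j < width n | big_at i.+1 j && ~~ big_at i j) a j.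
  rewrite [X in X - _](bigID (fun j : 'I_(width n) => big_at i.+1 j))/=.
  rewrite [X in _ + X - _](eq_bigl (fun j : 'I_(width n) => ~~ big_at i.+1 j)).
    by rewrite addrK; apply: eq_bigl => j; rewrite andbC.
  move=> j /=; case h : (big_at i j) => //=; first by rewrite (big_atS h).
rewrite -sumrN mulr_sumr; apply: ler_sum => j _.
rewrite lerNl -mulrN (le_trans (ler_norm _))// normrM normrN.
by rewrite ler_piMl.
Qed.

(** The upper estimate from [flat_part_le] is at most twice the lower
    estimate from [concentrated_stage]: the losses telescope over the scales, so
    their average is at most A / levels n, and weight n * A dominates it. *)
Lemma concentrated_half :
  weight n * A + share n * \sum_(i < levels n) (big_mass i.+1 + 2 * A / (levels n)%:R)
  <= 2 * (weight n * A +
     share n * \sum_(i < levels n) (2 * big_mass i - big_mass i.+1)).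
Proof.
have l0 : 0 < (levels n)%:R :> R by rewrite ltr0n levels_gt0.
(* The losses of the lower estimate add up to at most A. *)
have tele : \sum_(i < levels n) (big_mass i.+1 - big_mass i) <= A.
  rewrite -(big_mkord predT (fun i => big_mass i.+1 - big_mass i)).
  rewrite telescope_sumr// lerBlDr (le_trans (big_mass_le _))//.
  by rewrite lerDl big_mass_ge0.
have pos : 0 <= \sum_(i < levels n) big_mass i.
  by apply: sumr_ge0 => i _; exact: big_mass_ge0.
rewrite big_split/= sumr_const card_ord -[_ *+ _]mulr_natl.
have -> : (levels n)%:R * (2 * A / (levels n)%:R) = 2 * A.
  by rewrite mulrC divfK// gt_eqF.
rewrite sumrB in tele; rewrite sumrB -mulr_sumr.
set X := \sum_(i < levels n) big_mass i.+1 in tele *.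
set Y := \sum_(i < levels n) big_mass i in tele pos *.
have : share n * (X + 2 * A) + share n * (2 * X - 4 * Y) <= share n * (5 * A).
  by rewrite -mulrDr ler_wpM2l ?share_ge0//; lra.
have : share n * (5 * A) <= weight n * A.
  rewrite mulrA ler_wpM2r// weight_levels /share -mulrA [leLHS]mulrC -mulrA.
  have := weight_gt0 R n => w0; have : 0 < (levels n)%:R^-1 :> R by rewrite invr_gt0.
  nra.
lra.
Qed.

End stage_splitting.

Section splitting.
Context (R : realType).
Implicit Types (v : {poly R}) (n : nat).

(** The key property of the norm.  From v one removes the combination of
    the new vectors, corrected by the multiple of y it looks like.  What
    remains, v - e, is concentrated at every scale, hence is almost normed by
    functionals whose restriction to the old coordinates is arbitrary. *)
Lemma poly_norm_split n v : (size v <= dimen n.+1)%N ->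
  exists2 e : {poly R}, (size e <= dimen n)%N &
    forall u : {poly R}, (size u <= dimen n)%N ->
      poly_norm u + poly_norm (v - e) / 2 <= poly_norm (u + (v - e)).
Proof.
move=> vn; pose a j := v`_(dimen n + j).
have vn' := vn; rewrite dimenS in vn'.
pose c := flat_mass n a; pose e := take_poly (dimen n) v + c *: node R n.
have ed : (size e <= dimen n)%N.
  rewrite (leq_trans (size_polyD _ _))// geq_max size_take_poly.
  by rewrite (leq_trans (size_scale_leq _ _))// size_node.
have fE phi : pairing phi (v - e) = \sum_(j < width n) a j * phi (dimen n + j)%N -
    pairing phi (node R n) * c.
  by rewrite pairingB pairingD pairingZ (pairing_split _ vn') /a; ring.
have fd : (size (v - e)%R <= dimen n.+1)%N.
  rewrite (leq_trans (size_polyD _ _))// geq_max vn size_polyN.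
  by rewrite (leq_trans ed)// leq_dimen.
pose A := \sum_(j < width n) `|a j|.
have g0 := share_ge0 R n; have w0 := weight_gt0 R n.
(* Here c * y cancels the flat part at each scale, on average. *)
have upper : poly_norm (v - e) <= weight R n * A +
    share R n * \sum_(i < levels n) (big_mass n a i.+1 + 2 * A / (levels n)%:R).
  apply: (@poly_norm_le _ n.+1) => // phi Dphi; rewrite fE.
  have [chi [psi [chi1 psi1 cap pE]]] := dual_stage Dphi.
  set t := pairing phi (node R n) in cap *.
  have -> : \sum_(j < width n) a j * phi (dimen n + j)%N =
      weight R n * \sum_(j < width n) a j * chi j +
      share R n * \sum_(i < levels n) \sum_(j < width n) a j * psi i j.
    rewrite exchange_big/= !mulr_sumr -big_split/=; apply: eq_bigr => j _.
    by rewrite pE// -/(share R n) -!mulr_sumr; ring.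
  rewrite -addrA lerD//.
    rewrite ler_pM2l// ler_sum// => j _.
    by rewrite (le_trans (ler_norm _))// normrM ler_piMr.
  rewrite /c /flat_mass mulrCA -mulrBr ler_wpM2l// mulr_sumr -sumrB.
  by apply: ler_sum => i _; apply: flat_part_le => //; exact: cap.
exists e => // u un; apply/ler_addgt0Pr => r r0.
have [phi Dphi hphi] := poly_norm_adherent un r0.
have [p Sp hp] := @concentrated_stage R n a _ (pairing_node Dphi).
have [psi [Dpsi ephi ep]] := dual_extend Dphi Sp.
have sz : (size (u + (v - e))%R <= dimen n.+1)%N.
  rewrite (leq_trans (size_polyD _ _))// geq_max fd andbT.
  by rewrite (leq_trans un)// leq_dimen.
have := pairing_le_norm sz Dpsi; rewrite pairingD fE (eq_pairing un ephi).
rewrite (eq_pairing (size_node R n) ephi).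
rewrite (eq_bigr (fun j : 'I_(width n) => a j * p j)); last by move=> j _; rewrite ep.
have := @concentrated_half R n a; rewrite -/A in upper *.
move: hp hphi upper; rewrite -/A -/c; lra.
Qed.

End splitting.

(** * Bounded separated sequences have l1-like blocks *)

Section resolution.
Context (R : realType).
Implicit Types (u v : {poly R}) (P : nat -> {poly R}) (n : nat).
Local Notation rho := (@poly_norm R).

(** Iterated splitting of v: the increments of P are l1-orthogonal, up to the
    factor 2, to everything that precedes them.  The map from v to P is not
    linear. *)
Definition resolution v P : Prop :=
  [/\ forall n, (size (P n) <= dimen n)%N,
      exists N, forall n, (N <= n)%N -> P n = v
    & forall n u, (size u <= dimen n)%N ->
        rho u + rho (P n.+1 - P n) / 2 <= rho (u + (P n.+1 - P n))].

(** [poly_norm_split] is applied downwards from the stage where v lives. *)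
Lemma resolution_exists v : exists P, resolution v P.
Proof.
suff key N : forall w : {poly R}, (size w <= dimen N)%N -> exists P,
    [/\ forall n, (size (P n) <= dimen n)%N, forall n, (N <= n)%N -> P n = w
      & forall n u, (size u <= dimen n)%N ->
        rho u + rho (P n.+1 - P n) / 2 <= rho (u + (P n.+1 - P n))].
  have [P [sP Pv dP]] := key _ _ (dimen_ge (size v)).
  by exists P; split => //; exists (size v).
elim: N => [|N IH] w wN.
  have -> : w = 0 by apply/eqP; rewrite -size_poly_leq0; rewrite /dimen big_ord0 in wN.
  exists (fun=> 0); split=> // [n|n u _]; first by rewrite size_poly0.
  by rewrite subr0 addr0 poly_norm0 mul0r addr0.
have [e eN he] := poly_norm_split wN.
have [P [sP Pe dP]] := IH _ eN.
exists (fun n => if (n <= N)%N then P n else w); split.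
- move=> n; case: (leqP n N) => Nn; first exact: sP.
  rewrite (leq_trans wN)//.
  exact: leq_dimen.
- by move=> n Nn; rewrite leqNgt Nn.
- move=> n u un; case: (ltngtP n N) => [nN|nN|nN].
  + exact: dP.
  + by rewrite subrr poly_norm0 mul0r !addr0.
  + by rewrite nN Pe//; apply: he; rewrite -nN.
Qed.

Lemma resolution_sum v P n m u : resolution v P -> (n <= m)%N ->
  (size u <= dimen n)%N ->
  rho u + (\sum_(n <= i < m) rho (P i.+1 - P i)) / 2 <= rho (u + (P m - P n)).
Proof.
move=> [sP _ dP] /subnK <- un; elim: (m - n)%N => [|k IH].
  by rewrite add0n big_geq// mul0r subrr !addr0.
rewrite addSn big_nat_recr ?leq_addl//= mulrDl addrA.
have -> : u + (P (k + n).+1 - P n) =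
    u + (P (k + n)%N - P n) + (P (k + n).+1 - P (k + n)%N).
  by rewrite -addrA; congr (_ + _); rewrite [RHS]addrC addrA subrK.
apply: le_trans (dP _ _ _); first by rewrite lerD2r.
rewrite (leq_trans (size_polyD _ _))// geq_max (leq_trans un) ?leq_dimen ?leq_addl//=.
rewrite (leq_trans (size_polyD _ _))// geq_max sP size_polyN/=.
by rewrite (leq_trans (sP _))// leq_dimen// leq_addl.
Qed.

Lemma resolution_tail v P n u : resolution v P -> (size u <= dimen n)%N ->
  rho u + rho (v - P n) / 2 <= rho (u + (v - P n)).
Proof.
move=> rP un; have [sP [N PN] dP] := rP.
have <- : P (maxn N n) = v by apply: PN; rewrite leq_maxl.
apply: le_trans (resolution_sum rP (leq_maxr N n) un).
rewrite lerD2l ler_pM2r// -telescope_sumr ?leq_maxr//.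
exact: poly_norm_sum.
Qed.

Lemma resolution0 v P : resolution v P -> P 0%N = 0.
Proof.
move=> [sP _ _]; apply/eqP; rewrite -size_poly_leq0.
by have := sP 0%N; rewrite /dimen big_ord0.
Qed.

(** The increments form an l1 sum inside v. *)
Lemma resolution_variation v P n : resolution v P ->
  \sum_(0 <= i < n) rho (P i.+1 - P i) <= 2 * rho v.
Proof.
move=> rP; have [sP [N PN] dP] := rP.
have := @resolution_sum _ _ 0%N (maxn N n) 0 rP (leq0n _).
rewrite size_poly0 (PN _ (leq_maxl _ _)) (resolution0 rP) subr0 !add0r poly_norm0.
rewrite add0r => /(_ (leq0n _)).
rewrite ler_pdivrMr// [leRHS]mulrC; apply: le_trans.
rewrite [leRHS](big_cat_nat (n := n))/= ?leq_maxr// lerDl.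
by apply: sumr_ge0 => i _; exact: poly_norm_ge0.
Qed.

Lemma resolution_bound v P n : resolution v P -> rho (P n) <= 2 * rho v.
Proof.
move=> rP; apply: le_trans (resolution_variation n rP).
have -> : P n = \sum_(0 <= i < n) (P i.+1 - P i).
  by rewrite telescope_sumr// (resolution0 rP) subr0.
exact: poly_norm_sum.
Qed.

End resolution.

Section ultralimit.
Context (R : realType) (U : set_system nat) {UU : UltraFilter U}.
Local Notation rho := (@poly_norm R).

Lemma ultralimit_real (x : nat -> R) (C : R) : (forall m, `|x m| <= C) ->
  exists l, forall e, 0 < e -> U [set m | `|x m - l| < e].
Proof.
move=> xC; have xU : (x @ U) `[- C, C]%classic.
  suff : U [set m | `[- C, C]%classic (x m)] by [].
  by apply: filterE => m; rewrite /= in_itv/= -ler_norml xC.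
have [l [_ cl]] := @segment_compact R (- C) C (x @ U) _ xU.
exists l => e e0.
have [//|Uc] := in_ultra_setVsetC [set m | `|x m - l| < e] UU.
have [y [/= yA yB]] := cl (~` [set y | `|y - l| < e]) (ball l e) Uc (nbhsx_ballx _ _ e0).
by case: yA; rewrite /= distrC.
Qed.

Lemma ultralimit_poly (v : nat -> {poly R}) n (B : R) :
  (forall m, (size (v m) <= dimen n)%N) -> (forall m, rho (v m) <= B) ->
  exists2 p : {poly R}, (size p <= dimen n)%N &
    forall e, 0 < e -> U [set m | rho (v m - p) < e].
Proof.
move=> vn vB; have [C C0 hC] := coef_le_norm R n.
have lim j : exists l, forall e, 0 < e -> U [set m | `|(v m)`_j - l| < e].
  apply: (@ultralimit_real (fun m => (v m)`_j) (C * B)) => m.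
  by rewrite (le_trans (hC _ _ (vn m)))// ler_wpM2l.
have [l hl] := choice lim.
exists (\poly_(j < dimen n) l j) => [|e e0]; first exact: size_poly.
pose r := e / (dimen n).+1%:R; have r0 : 0 < r by rewrite divr_gt0.
have : \forall m \near U, forall j : 'I_(dimen n), `|(v m)`_j - l j| < r.
  apply: filter_forall => j; exact: hl.
apply: filterS => m h /=.
have -> : v m - \poly_(j < dimen n) l j =
    \sum_(j < dimen n) ((v m)`_j - l j) *: 'X^j.
  rewrite -{1}(@coefK _ (v m)) poly_def (big_ord_widen _ (fun j => (v m)`_j *: 'X^j) (vn m)).
  rewrite poly_def [X in X - _]big_mkcond/= -sumrB; apply: eq_bigr => j _.
  case: ltnP => jv; first by rewrite scalerBl.
  by rewrite nth_default// sub0r add0r scaleNr.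
rewrite (le_lt_trans (poly_norm_sum _ _))//.
apply: (@le_lt_trans _ _ (\sum_(j < dimen n) r)).
  apply: ler_sum => j _; rewrite poly_normZ -[leRHS]mulr1.
  by rewrite ler_pM// ?poly_norm_ge0 ?poly_norm_Xn_le1// ltW.
rewrite sumr_const card_ord -[r *+ _]mulr_natr /r -mulrA -[ltRHS]mulr1.
by rewrite ltr_pM2l// mulrC ltr_pdivrMr// mul1r ltr_nat.
Qed.

End ultralimit.

Section separated_sequences.
Context (R : realType) (v : nat -> {poly R}) (B c : R).
Local Notation rho := (@poly_norm R).
Hypothesis vB : forall m, rho (v m) <= B.
Hypothesis c0 : 0 < c.
Hypothesis vc : forall m l, m != l -> c <= rho (v m - v l).

(** Along an ultrafilter the n-th terms of the resolutions of v m converge to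
    some p n, and the p n have bounded variation by [resolution_variation].  So
    they are close to one fixed p from some index n0 on, and for each n >= n0
    infinitely many v m have their n-th term close to p. *)
Lemma common_part e : 0 < e -> exists (P : nat -> nat -> {poly R}) n0 p,
  (forall m, resolution (v m) (P m)) /\
  forall n k, (n0 <= n)%N -> exists2 m, (k <= m)%N & rho (P m n - p) < e.
Proof.
move=> e0; have [P rP] := choice (fun m => resolution_exists (v m)).
have [U [UU oU]] := ultraFilterLemma (@eventually_filter).
have lim n : exists p : {poly R}, forall r, 0 < r -> U [set m | rho (P m n - p) < r].
  have [||p _ hp] := @ultralimit_poly R U UU (P ^~ n) n (2 * B); last by exists p.
    by move=> m; have [] := rP m.
  by move=> m; rewrite (le_trans (resolution_bound n (rP m)))// ler_pM2l.
have [p hp] := choice lim.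
(* The bound on the variation passes to the limit: compare with one m that is
   good for the first n.+1 indices. *)
pose S n := \sum_(0 <= i < n) rho (p i.+1 - p i).
have SB n : S n <= 2 * B.
  apply/ler_addgt0Pr => r r0.
  pose q := r / (2 * n.+1%:R).
  have q0 : 0 < q by rewrite divr_gt0// mulr_gt0.
  have : \forall m \near U, forall i : 'I_n.+1, rho (P m i - p i) < q.
    by apply: filter_forall => i; exact: hp.
  move=> /filter_ex[m hm].
  apply: le_trans (lerD (le_trans (resolution_variation n (rP m))
    (ler_wpM2l (ler0n _ 2) (vB m))) (lexx r)).
  apply: (@le_trans _ _ (\sum_(0 <= i < n) (rho (P m i.+1 - P m i) + 2 * q))).
    rewrite /S !big_mkord; apply: ler_sum => i _.
    have -> : p i.+1 - p i = (P m i.+1 - P m i) - (P m i.+1 - p i.+1) + (P m i - p i).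
      ring.
    have in1 : (i < n.+1)%N by rewrite ltnS ltnW.
    have h1 := hm (Ordinal in1).
    have h2 := hm (lift ord0 i); rewrite /= /bump/= add1n in h2.
    rewrite (le_trans (poly_normD _ _))//.
    have := poly_normD (P m i.+1 - P m i) (- (P m i.+1 - p i.+1)).
    rewrite poly_normN; rewrite /= in h1; lra.
  rewrite big_split/= lerD2l sumr_const_nat subn0 -[_ *+ _]mulr_natl.
  have n1 : n.+1%:R != 0 :> R by rewrite pnatr_eq0.
  have -> : n%:R * (2 * q) = n%:R / n.+1%:R * r :> R.
    by rewrite /q invfM; field; rewrite addrC natr1.
  by rewrite ler_piMl ?(ltW r0)// ler_pdivrMr// mul1r ler_nat.
have [n0 hn0] : exists n0, forall n, (n0 <= n)%N -> S n - S n0 <= e / 2.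
  have hS : has_sup (range S).
    by split; [exists (S 0%N), 0%N|exists (2 * B) => _ [n _ <-]].
  have e2 : 0 < e / 2 by rewrite divr_gt0.
  have [_ [n0 _ <-] h] := sup_adherent e2 hS.
  exists n0 => n _; have : S n <= sup (range S).
    by apply: sup_upper_bound => //; exists n.
  lra.
exists P, n0, (p n0); split => // n k n0n.
have pn : rho (p n - p n0) <= e / 2.
  apply: le_trans (hn0 _ n0n).
  rewrite /S (big_cat_nat (n := n0))//= addrAC subrr add0r -telescope_sumr//.
  exact: poly_norm_sum.
have e2 : 0 < e / 2 by rewrite divr_gt0.
have Uk : U [set m | (k <= m)%N] by apply: oU; exists k.
have [m [/= km hm]] := filter_ex (filterI Uk (hp n _ e2)).
exists m => //; have -> : P m n - p n0 = (P m n - p n) + (p n - p n0) by ring.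
by rewrite (le_lt_trans (poly_normD _ _))// [ltRHS]splitr ltr_leD.
Qed.

(** Take v m and v m' with n-th and n1-th terms close to the common part p,
    where n1 is beyond the stage of v m.  In the difference v m - v m' the
    common part cancels, and the remainders h and h' are l1-orthogonal to all
    that was chosen before.  As v m and v m' are c apart, each such pair adds
    about c / 2 to the norm. *)
Lemma separated_l1_sums M : exists s1 s2 : seq nat,
  [/\ size s1 = M, size s2 = M, uniq (s1 ++ s2) &
    M%:R * c / 4 <= rho (\sum_(m <- s1) v m - \sum_(m <- s2) v m)].
Proof.
pose e := c / 12; have e0 : 0 < e by rewrite divr_gt0.
have [P [n0 [p [rP hP]]]] := common_part e0.
suff [s1 [s2 [n [H [sz1 sz2 un [n0n Hn HM]]]]]] :
  exists (s1 s2 : seq nat) n (H : {poly R}),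
  [/\ size s1 = M, size s2 = M, uniq (s1 ++ s2) &
    [/\ (n0 <= n)%N, (size H <= dimen n)%N,
       M%:R * ((c - 2 * e) / 2) <= rho H &
       rho (\sum_(m <- s1) v m - \sum_(m <- s2) v m - H) <= M%:R * (2 * e)]].
  move=> HS; exists s1, s2; split=> //.
  set V := \sum_(m <- s1) v m - _ in HS *.
  have : rho H <= rho V + rho (V - H).
    by rewrite (poly_normB V H) (le_trans _ (poly_normD _ _))// addrC subrK.
  rewrite /e in HM HS; move: HM HS; lra.
elim: M => [|M [s1 [s2 [n [H [sz1 sz2 un [n0n Hn HM HS]]]]]]].
  exists [::], [::], n0, 0; split=> //; split=> //; first by rewrite size_poly0.
    by rewrite mul0r poly_norm0.
  by rewrite !big_nil !subr0 poly_norm0 mul0r.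
(* Indices from k on do not occur in s1 ++ s2. *)
pose k := (\sum_(m <- s1 ++ s2) m).+1.
have fresh m : (k <= m)%N -> m \notin s1 ++ s2.
  move=> km; apply/negP => ms; move: km; rewrite /k (big_rem _ ms)/=.
  by rewrite ltnNge leq_addr.
have [m km hm] := hP n k n0n.
pose n1 := maxn n (size (v m)).
have nn1 : (n <= n1)%N by exact: leq_maxl.
have [m' km' hm'] := hP n1 (maxn k m.+1) (leq_trans n0n nn1).
move: km'; rewrite geq_max => /andP[km' mm'].
pose h := v m - P m n; pose h' := v m' - P m' n1.
have dn : (dimen n <= dimen n1)%N by exact: leq_dimen.
have hn1 : (size (H + h)%R <= dimen n1)%N.
  rewrite (leq_trans (size_polyD _ _))// geq_max (leq_trans Hn)//=.
  rewrite (leq_trans (size_polyD _ _))// geq_max size_polyN.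
  rewrite (leq_trans (leq_maxr n _) (dimen_ge _))/=.
  by have [sP _ _] := rP m; rewrite (leq_trans (sP n)).
pose n2 := maxn n1 (size (v m')).
have dn2 : (dimen n1 <= dimen n2)%N by rewrite leq_dimen// leq_maxl.
exists (m :: s1), (m' :: s2), n2, (H + h - h'); split.
- by rewrite /= sz1.
- by rewrite /= sz2.
- rewrite cat_cons cons_uniq mem_cat in_cons orbCA -mem_cat negb_or fresh//.
  rewrite (ltn_eqF mm')/= -(cat1s m' s2) uniq_catCA cat1s cons_uniq un andbT.
  exact: fresh.
- split.
  + by rewrite (leq_trans n0n)// (leq_trans nn1)// leq_maxl.
  + rewrite (leq_trans (size_polyD _ _))// geq_max (leq_trans hn1)//= size_polyN.
    rewrite (leq_trans (size_polyD _ _))// geq_max size_polyN.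
    rewrite (leq_trans (leq_maxr n1 _) (dimen_ge _))/=.
    by have [sP _ _] := rP m'; rewrite (leq_trans (sP n1)).
  + have h1 := resolution_tail (rP m) Hn.
    have h2 : rho (H + h) + rho h' / 2 <= rho (H + h - h').
      have szN : (size (- (H + h))%R <= dimen n1)%N by rewrite size_polyN.
      have := resolution_tail (rP m') szN.
      by rewrite poly_normN -/h' -(poly_normN (- (H + h) + h')) opprD opprK.
    have h3 : c - 2 * e <= rho h + rho h'.
      have := poly_normD h (- h'); rewrite poly_normN => h4.
      have h5 : rho (v m - v m') <= rho (h - h') + rho (P m n - P m' n1).
        rewrite (le_trans _ (poly_normD _ _))//.
        by have -> : h - h' + (P m n - P m' n1) = v m - v m' by rewrite /h /h'; ring.
      have h6 : rho (P m n - P m' n1) <= 2 * e.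
        have -> : P m n - P m' n1 = (P m n - p) - (P m' n1 - p) by ring.
        rewrite (le_trans (poly_normD _ _))// poly_normN; lra.
      have : c <= rho (v m - v m') by apply: vc; rewrite (ltn_eqF mm').
      lra.
    rewrite -addn1 natrD; rewrite -/h in h1; lra.
  + rewrite !big_cons.
    have -> : v m + \sum_(j <- s1) v j - (v m' + \sum_(j <- s2) v j) - (H + h - h') =
      (\sum_(j <- s1) v j - \sum_(j <- s2) v j - H) + ((P m n - p) - (P m' n1 - p)).
      by rewrite /h /h'; ring.
    rewrite (le_trans (poly_normD _ _))// -addn1 natrD mulrDl lerD// mul1r.
    rewrite (le_trans (poly_normD _ _))// poly_normN; lra.
Qed.

End separated_sequences.

(** * Countably generated spaces as quotients *)

(** In the application cf n is the integral over the n-th piece of a partition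
    and g n is the normalized indicator of that piece, so that V projects onto
    the span of the g n, a copy of l1.  Sending g n to u n then presents the
    completion of X as a quotient of V.  The function lift only chooses
    representatives; it becomes linear modulo the kernel. *)
Section quotient_model.
Local Open Scope quotient_scope.
Context (R : realType) (V : normedModType R) (X : lmodType R).
Variables (rho : X -> R) (u : nat -> X) (cf : nat -> V -> R) (g : nat -> V).
Variable lift : X -> V.
Hypothesis rhoD : forall x y, rho (x + y) <= rho x + rho y.
Hypothesis rhoZ : forall a x, rho (a *: x) = `|a| * rho x.
Hypothesis u_le1 : forall n, rho (u n) <= 1.
Hypothesis cf_lin : forall n a f h, cf n (a *: f + h) = a * cf n f + cf n h.
Hypothesis cf_sum : forall N f, \sum_(n < N) `|cf n f| <= `|f|.
Hypothesis g_le1 : forall n, `|g n| <= 1.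
Hypothesis cf_g : forall m n, cf m (g n) = (m == n)%:R.
Hypothesis cf_tail : forall f e, 0 < e -> exists N f',
  `|f - f'| < e /\ forall n, (N <= n)%N -> cf n f' = 0.
Let S N f := \sum_(n < N) cf n f *: u n.
Hypothesis liftK : forall x, exists N0, forall N, (N0 <= N)%N -> S N (lift x) = x.
Hypothesis lift_dense : forall x e, rho x < 1 -> 0 < e ->
  exists n, `|lift (x - u n)| <= e.

Let rho0 : rho 0 = 0.
Proof. by rewrite -(scale0r 0) rhoZ normr0 mul0r. Qed.

Let rhoN x : rho (- x) = rho x.
Proof. by rewrite -scaleN1r rhoZ normrN1 mul1r. Qed.

Let rho_ge0 x : 0 <= rho x.
Proof. by have := rhoD x (- x); rewrite subrr rho0 rhoN; lra. Qed.

Let S_lin N a f h : S N (a *: f + h) = a *: S N f + S N h.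
Proof.
rewrite /S scaler_sumr -big_split/=; apply: eq_bigr => n _.
by rewrite cf_lin scalerDl scalerA.
Qed.

Let SB N f h : S N (f - h) = S N f - S N h.
Proof.
have -> : f - h = -1 *: h + f by rewrite scaleN1r addrC.
by rewrite S_lin scaleN1r addrC.
Qed.

Let rhoS N f : rho (S N f) <= `|f|.
Proof.
apply: le_trans (cf_sum N f); rewrite /S.
elim/big_ind2 : _ => [|x1 x2 y1 y2 h1 h2|n _]; first by rewrite rho0.
  by rewrite (le_trans (rhoD _ _))// lerD.
by rewrite rhoZ ler_piMr.
Qed.

Let null f := forall e, 0 < e ->
  exists N0, forall N, (N0 <= N)%N -> rho (S N f) <= e.
Let Yp : {pred V} := fun f => `[< null f >].

Let null_lin a f h : null f -> null h -> null (a *: f + h).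
Proof.
move=> nf nh e e0; have e2 : 0 < e / 2 by rewrite divr_gt0.
have a1 : 0 < `|a| + 1 by rewrite ltr_wpDl.
have ea : 0 < e / 2 / (`|a| + 1) by rewrite divr_gt0.
have [N1 h1] := nf _ ea; have [N2 h2] := nh _ e2.
exists (maxn N1 N2) => N; rewrite geq_max => /andP[N1N N2N].
rewrite S_lin (le_trans (rhoD _ _))// rhoZ [leRHS]splitr lerD ?h2//.
rewrite (le_trans (ler_wpM2l (normr_ge0 a) (h1 _ N1N)))//.
by rewrite mulrCA ler_piMr ?(ltW e2)// ler_pdivrMr// mul1r lerDl.
Qed.

Let null0 f N0 : (forall N, (N0 <= N)%N -> S N f = 0) -> null f.
Proof. by move=> h e e0; exists N0 => N /h ->; rewrite rho0 ltW. Qed.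

Let Y_submod : GRing.submod_closed Yp.
Proof.
split.
  apply/asboolP/(@null0 _ 0%N) => N _; have := SB N 0 0; rewrite subrr.
  by rewrite subrr.
by move=> a f h /asboolP nf /asboolP nh; apply/asboolP; exact: null_lin.
Qed.

Let Y_closed : closed [set f | f \in Yp].
Proof.
move=> f clf; apply/asboolP => e e0; have e2 : 0 < e / 2 by rewrite divr_gt0.
have [h [/= /asboolP nh hf]] := clf _ (nbhsx_ballx f _ e2).
have [N0 hN] := nh _ e2; exists N0 => N /hN hN'.
have -> : S N f = S N h + S N (f - h) by rewrite SB addrC subrK.
rewrite (le_trans (rhoD _ _))// [leRHS]splitr lerD// (le_trans (rhoS _ _))//.
by rewrite -ball_normE /= in hf; rewrite ltW.
Qed.

Let Y : closedSubspace V := ClosedSubspace Y_submod Y_closed.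
Local Notation Q := (quotient_space Y).

Let pi_eq f h : null (f - h) -> \pi_Q f = \pi_Q h.
Proof. by move=> n; apply/quotient_eqP/asboolP. Qed.

Let iota x : Q := \pi_Q (lift x).

(* Two elements of V with the same image in X agree modulo the kernel. *)
Let S_eventually x f : (exists N0, forall N, (N0 <= N)%N -> S N f = x) ->
  \pi_Q f = iota x.
Proof.
move=> [N1 h1]; have [N2 h2] := liftK x; apply/pi_eq/(@null0 _ (maxn N1 N2)) => N.
by rewrite geq_max => /andP[/h1 e1 /h2 e2]; rewrite SB e1 e2 subrr.
Qed.

Let piD f h : \pi_Q (f + h) = \pi_Q f + \pi_Q h.
Proof. exact: pi_quotientD. Qed.

Let piZ a f : \pi_Q (a *: f) = a *: (\pi_Q f : Q).
Proof. exact: pi_quotientZ. Qed.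

Let iota_lin a x y : iota (a *: x + y) = a *: iota x + iota y.
Proof.
rewrite /iota -piZ -piD; apply/esym/S_eventually.
have [N1 h1] := liftK x; have [N2 h2] := liftK y; exists (maxn N1 N2) => N.
by rewrite geq_max => /andP[/h1 e1 /h2 e2]; rewrite S_lin e1 e2.
Qed.

Let norm_iota_ge x : rho x <= `|iota x|.
Proof.
apply/ler_addgt0Pr => e e0; have e2 : 0 < e / 2 by rewrite divr_gt0.
have [z zq ze] := quotient_norm_adherent (iota x) e2.
have /asboolP nz : lift x - z \in Y by apply/quotient_eqP; rewrite zq.
have [N1 h1] := nz _ e2; have [N2 h2] := liftK x.
have := h1 _ (leq_maxl N1 N2); rewrite SB (h2 _ (leq_maxr N1 N2)).
set s := S _ z => h3; have h4 : rho s <= `|z| by exact: rhoS.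
have := rhoD (x - s) s; rewrite subrK.
rewrite -[`|iota x|]/(quotient_norm (iota x)); lra.
Qed.

Let iota_u n : iota (u n) = \pi_Q (g n).
Proof.
apply/esym/S_eventually; exists n.+1 => N nN; rewrite /S (bigD1 (Ordinal nN))//=.
rewrite cf_g eqxx scale1r big1 ?addr0// => m; rewrite -val_eqE/= => /negPf mn.
by rewrite cf_g mn scale0r.
Qed.

Let pi_norm f : `|\pi_Q f : Q| <= `|f|.
Proof. exact: quotient_norm_le. Qed.

Let norm_iota_le1 x : rho x < 1 -> `|iota x| <= 1.
Proof.
move=> x1; apply/ler_addgt0Pl => e e0; have [n hn] := lift_dense x1 e0.
have -> : iota x = iota (x - u n) + iota (u n).
  have := iota_lin 1 (x - u n) (u n).
  by rewrite !scale1r subrK.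
rewrite (le_trans (ler_normD _ _))// lerD//; first exact: le_trans (pi_norm _) hn.
by rewrite iota_u (le_trans (pi_norm _)).
Qed.

Let norm_iota x : `|iota x| = rho x.
Proof.
apply/eqP; rewrite eq_le norm_iota_ge andbT; apply/ler_addgt0Pr => e e0.
have s0 : 0 < rho x + e by rewrite ltr_wpDl.
have : rho ((rho x + e)^-1 *: x) < 1.
  by rewrite rhoZ gtr0_norm ?invr_gt0// mulrC ltr_pdivrMr// mul1r ltrDl.
move=> /norm_iota_le1.
have -> : iota ((rho x + e)^-1 *: x) = (rho x + e)^-1 *: iota x.
  have i0 : iota 0 = 0.
    have := iota_lin 1 0 0; rewrite !scale1r addr0 => /eqP.
    by rewrite addrC -subr_eq subrr => /eqP.
  by have := iota_lin (rho x + e)^-1 x 0; rewrite i0 !addr0.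
by rewrite normrZ gtr0_norm ?invr_gt0// mulrC ler_pdivrMr// mul1r.
Qed.

Let iota_dense (q : Q) e : 0 < e -> exists x, `|q - iota x| < e.
Proof.
move=> e0; have -> : q = \pi_Q (repr q) by rewrite reprK.
have [N [f [fe fN]]] := cf_tail (repr q) e0; exists (S N f).
have <- : \pi_Q f = iota (S N f).
  apply: S_eventually; exists N => M NM; rewrite /S (big_ord_widen _ (fun n => cf n f *: u n) NM).
  rewrite [RHS]big_mkcond/=; apply: eq_bigr => n _; case: ltnP => // /fN ->.
  by rewrite scale0r.
have -> : \pi_Q (repr q) - \pi_Q f = \pi_Q (repr q - f).
  by rewrite piD -[in RHS](scaleN1r f) piZ scaleN1r.
exact: le_lt_trans (pi_norm _) fe.
Qed.

(** The kernel Z consists of the f whose images, the partial sums of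
    cf n f *: u n, tend to 0 for rho.  Working with partial sums avoids the
    completion of X. *)
Lemma quotient_model : exists (Z : closedSubspace V) (j : X -> quotient_space Z),
  [/\ forall a x y, j (a *: x + y) = a *: j x + j y,
      forall x, `|j x| = rho x
    & forall q e, 0 < e -> exists x, `|q - j x| < e].
Proof. by exists Y, iota. Qed.

End quotient_model.

(** * Rational polynomials and the quotient model of the sequence space *)

Section rational_density.
Context (R : realType).
Implicit Types (v : {poly R}) (n : nat).
Local Notation rho := (@poly_norm R).

Lemma poly_norm_le_coef v n : (size v <= n)%N -> rho v <= \sum_(j < n) `|v`_j|.
Proof.
move=> vn; rewrite -{1}(@coefK _ v) poly_def (le_trans (poly_norm_sum _ _))//.
rewrite [leRHS](bigID (fun j : 'I_n => (j < size v)%N))/=.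
rewrite -(big_ord_widen _ (fun j => `|v`_j|) vn) -[leLHS]addr0 lerD//; last first.
  exact: sumr_ge0.
apply: ler_sum => j _; rewrite poly_normZ ler_piMr//.
exact: poly_norm_Xn_le1.
Qed.

Lemma rational_poly_approx v e : 0 < e -> exists q : {poly rat},
  (size (map_poly ratr q : {poly R}) <= size v)%N /\
  \sum_(j < size v) `|(v - map_poly ratr q)`_j| <= e.
Proof.
move=> e0; pose d := e / (size v).+1%:R; have d0 : 0 < d by rewrite divr_gt0.
have rat_near j : exists q : rat, `|v`_j - ratr q| < d.
  have : v`_j - d < v`_j + d by rewrite ltrD2l gtrN.
  move=> /rat_in_itvoo[q]; rewrite in_itv/= => /andP[q1 q2].
  by exists q; rewrite ltr_norml; lra.
have [q hq] := choice rat_near.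
have sz : (size (map_poly ratr (\poly_(j < size v) q j) : {poly R}) <= size v)%N.
  by rewrite (leq_trans (size_poly _ _))// size_poly.
exists (\poly_(j < size v) q j); split=> //.
apply: (@le_trans _ _ (\sum_(j < size v) d)).
  apply: ler_sum => j _; rewrite coefB coef_map coef_poly ltn_ord/=.
  exact/ltW/hq.
rewrite sumr_const card_ord -[_ *+ _]mulr_natr /d -mulrA -[leRHS]mulr1.
by rewrite ler_pM2l// mulrC ler_pdivrMr// mul1r ler_nat.
Qed.

(** The approximation is in the sum of the coefficients, which dominates both
    the norm and the norm of the lift to the l1 copy. *)
Lemma rational_ball_approx v e : rho v < 1 -> 0 < e -> exists q : {poly rat},
  [/\ (size (map_poly ratr q : {poly R}) <= size v)%N,
      \sum_(j < size v) `|(v - map_poly ratr q)`_j| <= e,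
      rho (map_poly ratr q) <= 1 & rho (v - map_poly ratr q) <= e].
Proof.
move=> v1 e0; pose d := Num.min e (1 - rho v).
have d0 : 0 < d by rewrite lt_min e0 subr_gt0.
have [q [sq hq]] := rational_poly_approx v d0.
set p := map_poly ratr q in sq hq *.
have vp : rho (v - p) <= d.
  rewrite (le_trans _ hq)// poly_norm_le_coef//.
  by rewrite (leq_trans (size_polyD _ _))// geq_max leqnn size_polyN.
have de : d <= e by rewrite ge_min lexx.
have d1 : d <= 1 - rho v by rewrite ge_min lexx orbT.
exists q; split=> //; rewrite -/p ?(le_trans hq)// ?(le_trans vp)//.
have := poly_normD v (p - v); rewrite addrC subrK poly_normB; lra.
Qed.

End rational_density.

Section poly_quotient_model.
Context (R : realType) (V : normedModType R).
Variables (cf : nat -> V -> R) (g : nat -> V).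
Hypothesis cf_lin : forall n a f h, cf n (a *: f + h) = a * cf n f + cf n h.
Hypothesis cf_sum : forall N f, \sum_(n < N) `|cf n f| <= `|f|.
Hypothesis g_le1 : forall n, `|g n| <= 1.
Hypothesis cf_g : forall m n, cf m (g n) = (m == n)%:R.
Hypothesis cf_tail : forall f e, 0 < e -> exists N f',
  `|f - f'| < e /\ forall n, (N <= n)%N -> cf n f' = 0.
Local Notation rho := (@poly_norm R).

Let u n : {poly R} :=
  let p := if unpickle n is Some q then map_poly ratr (q : {poly rat}) else 0 in
  if rho p <= 1 then p else 0.

Let u_le1 n : rho (u n) <= 1.
Proof. by rewrite /u; case: ifPn => // _; rewrite poly_norm0. Qed.

Let u_rat (q : {poly rat}) : rho (map_poly ratr q) <= 1 ->
  u (pickle q) = map_poly ratr q.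
Proof. by rewrite /u pickleK => ->. Qed.

Let idx j := pickle ('X^j : {poly rat}).

Let u_idx j : u (idx j) = 'X^j.
Proof. by rewrite u_rat map_polyXn// poly_norm_Xn_le1. Qed.

Let lift (v : {poly R}) : V := \sum_(j < size v) v`_j *: g (idx j).

Let liftK v : exists N0, forall N, (N0 <= N)%N ->
  \sum_(n < N) cf n (lift v) *: u n = v.
Proof.
have cf_sumr n (s : nat) (F : nat -> V) (a : nat -> R) :
    cf n (\sum_(j < s) a j *: F j) = \sum_(j < s) a j * cf n (F j).
  elim: s => [|s IH].
    rewrite !big_ord0; have := cf_lin n 1 0 0.
    by rewrite scale1r addr0 mul1r => /eqP; rewrite addrC -subr_eq subrr => /eqP.
  by rewrite !big_ord_recr/= addrC cf_lin IH addrC.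
exists (\sum_(j < size v) (idx j).+1)%N => N hN.
have idxN (j : 'I_(size v)) : (idx j < N)%N.
  by rewrite (leq_trans _ hN)// (bigD1 j)//= leq_addr.
under eq_bigr => n _ do rewrite (cf_sumr n (size v) (fun j => g (idx j)) (fun j => v`_j)) scaler_suml.
rewrite exchange_big/= -[RHS](@coefK _ v) poly_def; apply: eq_bigr => j _.
rewrite (bigD1 (Ordinal (idxN j)))//= cf_g eqxx mulr1 u_idx big1 ?addr0// => n.
by rewrite -val_eqE/= => /negPf nj; rewrite cf_g nj mulr0 scale0r.
Qed.

Let lift_dense v e : rho v < 1 -> 0 < e -> exists n, `|lift (v - u n)| <= e.
Proof.
move=> v1 e0; have [q [sq hq q1 _]] := rational_ball_approx v1 e0.
exists (pickle q); rewrite u_rat// (le_trans (ler_norm_sum _ _ _))//.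
apply: le_trans hq.
have sz : (size (v - map_poly ratr q : {poly R})%R <= size v)%N.
  by rewrite (leq_trans (size_polyD _ _))// geq_max leqnn size_polyN.
rewrite [leRHS](bigID (fun j : 'I_(size v) =>
  (j < size (v - map_poly ratr q : {poly R})%R)%N))/=.
rewrite -(big_ord_widen _ (fun j => `|(v - map_poly ratr q)`_j|) sz).
rewrite -[leLHS]addr0 lerD//; last exact: sumr_ge0.
by apply: ler_sum => j _; rewrite normrZ ler_piMr.
Qed.

Lemma poly_quotient_model :
  exists (Z : closedSubspace V) (j : {poly R} -> quotient_space Z),
  [/\ forall a x y, j (a *: x + y) = a *: j x + j y,
      forall x, `|j x| = rho x
    & forall q e, 0 < e -> exists x, `|q - j x| < e].
Proof.
apply: (@quotient_model R V {poly R} rho u cf g lift) => //.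
- exact: poly_normD.
- exact: poly_normZ.
Qed.

End poly_quotient_model.

(** * A criterion for the Daugavet property *)

Section daugavet_criterion.
Context (R : realType) (W : normedModType R).

(** Every y of the open unit ball is almost a mean of unit ball vectors z i
    that are almost l1-orthogonal to x. *)
Definition daugavet_means : Prop :=
  forall (x y : W) (e : R), `|y| < 1 -> 0 < e -> exists (k : nat) (z : nat -> W),
    [/\ (0 < k)%N,
        forall i, (i < k)%N -> `|z i| <= 1 /\ `|x| + 1 - e <= `|x + z i|
      & `|y - k%:R^-1 *: \sum_(i < k) z i| <= e].

Lemma exists_ge_mean k (f : nat -> R) : (0 < k)%N ->
  exists2 i, (i < k)%N & k%:R^-1 * \sum_(l < k) f l <= f i.
Proof.
move=> k0; apply: contrapT => h.
have lt i : (i < k)%N -> f i < k%:R^-1 * \sum_(l < k) f l.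
  by move=> ik; rewrite ltNge; apply/negP => fi; apply: h; exists i.
have kr0 : 0 < k%:R :> R by rewrite ltr0n.
have : \sum_(i < k) f i < \sum_(i < k) (k%:R^-1 * \sum_(l < k) f l).
  apply: ltr_sum => [|i _]; last exact: lt.
  by apply/hasP; exists (Ordinal k0); rewrite ?mem_index_enum.
by rewrite sumr_const card_ord -[ltRHS]mulr_natl mulrA mulfV ?gt_eqF// mul1r ltxx.
Qed.

Lemma has_sup_unit_image (T : {linear W -> W}) : bounded_fun_norm T ->
  has_sup [set `|T x| | x in [set x | `|x| <= 1]].
Proof.
move=> /(_ 1)[M TM]; split; first by exists `|T 0|, 0; rewrite //= normr0.
by exists M => _ [x /= x1 <-]; exact: TM.
Qed.

Lemma operator_norm_ge (T : {linear W -> W}) x : bounded_fun_norm T ->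
  `|T x| <= operator_norm T * `|x|.
Proof.
move=> bT; have [->|x0] := eqVneq x 0; first by rewrite linear0 !normr0 mulr0.
have nx : 0 < `|x| by rewrite normr_gt0.
rewrite -ler_pdivrMr//.
have -> : `|T x| / `|x| = `|T (`|x|^-1 *: x)|.
  by rewrite linearZ normrZ gtr0_norm ?invr_gt0// mulrC.
apply: sup_upper_bound; first exact: has_sup_unit_image.
by exists (`|x|^-1 *: x) => //=; rewrite normrZ gtr0_norm ?invr_gt0// mulVf// gt_eqF.
Qed.

(** Write T z = phi z *: w, and choose y almost norming T with phi y >= 0.
    Applied to x = T y, the hypothesis gives z i whose mean is near y; for one of
    them phi (z i) is not below the mean, so T (z i) is close to T y and
    z i + T (z i) has norm almost 1 + |T y|. *)
Lemma daugavet_of_means : daugavet_means -> daugavet_property W.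
Proof.
move=> dm T bT [w w0 rT]; set N := operator_norm T.
have nw : 0 < `|w| by rewrite normr_gt0.
have TN x : `|T x| <= N * `|x| by exact: operator_norm_ge.
have N0 : 0 <= N.
  apply: sup_upper_bound; first exact: has_sup_unit_image.
  by exists 0; rewrite /= ?normr0// linear0 normr0.
have upper x : `|x| <= 1 -> `|(idfun \+ T) x| <= 1 + N.
  move=> x1; rewrite (le_trans (ler_normD _ _))// lerD//.
  by rewrite (le_trans (TN x))// ler_piMr.
have hs : has_sup [set `|(idfun \+ T) x| | x in [set x | `|x| <= 1]].
  split; first by exists `|(idfun \+ T) 0|, 0; rewrite //= normr0.
  by exists (1 + N) => _ [x /= x1 <-]; exact: upper.
apply/eqP; rewrite eq_le; apply/andP; split.
  by apply: ge_sup => [|_ [x /= x1 <-]]; [case: hs|exact: upper].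
have /choice[phi hphi] : forall z, exists a : R, T z = a *: w.
  move=> z; have : range T (T z) by exists z.
  by rewrite rT => -[a _ <-]; exists a.
apply/ler_addgt0Pr => r r0.
pose e := Num.min 1 (r / (N + 5)).
have N5 : 0 < N + 5 by rewrite ltr_wpDl.
have e0 : 0 < e by rewrite lt_min ltr01 divr_gt0.
have er : e * (N + 5) <= r by rewrite -ler_pdivlMr// ge_min lexx orbT.
have [_ [x0 /= x01 <-] hx0] := sup_adherent e0 (has_sup_unit_image bT).
have {}hx0 : N - e < `|T x0| by [].
(* Shrink x0 slightly to enter the open ball, and change its sign if phi x0 is
   negative. *)
have [y [y1 phiy hy]] : exists y, [/\ `|y| < 1, 0 <= phi y & N - 2 * e <= `|T y|].
  pose d := e / (N + 2); have N2 : 0 < N + 2 by rewrite ltr_wpDl.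
  have d0 : 0 < d by rewrite divr_gt0.
  have dN : d * (N + 2) = e by rewrite /d divfK// gt_eqF.
  have d1 : d < 1.
    by rewrite /d ltr_pdivrMr// mul1r (@le_lt_trans _ _ 1) ?ge_min ?lexx// ltr_wpDl// ltr1n.
  have key s : `|s| = 1 -> 0 <= s * phi x0 ->
      exists y, [/\ `|y| < 1, 0 <= phi y & N - 2 * e <= `|T y|].
    move=> s1 sphi; exists ((1 - d) * s *: x0); split.
    - rewrite normrZ normrM s1 mulr1 gtr0_norm ?subr_gt0//.
      by rewrite (@le_lt_trans _ _ (1 - d))// ?ler_piMr ?subr_ge0 ?(ltW d1)// ltrBlDr ltrDl.
    - have : T ((1 - d) * s *: x0) = ((1 - d) * s * phi x0) *: w.
        by rewrite linearZ/= hphi scalerA.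
      rewrite hphi => /eqP; rewrite -subr_eq0 -scalerBl scaler_eq0 (negPf w0) orbF.
      by rewrite subr_eq0 => /eqP ->; rewrite -mulrA mulr_ge0// subr_ge0 ltW.
    - rewrite [X in `|X|]linearZ/= normrZ normrM s1 mulr1 gtr0_norm ?subr_gt0//.
      have : `|T x0| <= N by rewrite (le_trans (TN _))// ler_piMr.
      move=> h1; have : d * `|T x0| <= d * (N + 2) by rewrite ler_pM2l//; lra.
      lra.
  have [p0|p0] := leP 0 (phi x0).
    by apply: (key 1); rewrite ?normr1 ?mul1r.
  by apply: (key (-1)); rewrite ?normrN1 ?mulN1r ?oppr_ge0 ?(ltW p0).
have [k [z [k0 hz hmean]]] := dm (T y) y e y1 e0.
have [i ik hi] := exists_ge_mean (fun l => phi (z l)) k0.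
have [zi1 hzi] := hz i ik.
have meanE : T (k%:R^-1 *: \sum_(l < k) z l) = (k%:R^-1 * \sum_(l < k) phi (z l)) *: w.
  rewrite linearZ/= linear_sum/= (eq_bigr (fun l : 'I_k => phi (z l) *: w)) => [|l _]; last first.
    exact: hphi.
  by rewrite -scaler_suml scalerA.
set mu := k%:R^-1 * _ in meanE.
have lo : (phi y - phi (z i)) * `|w| <= N * e.
  have : `|T (y - k%:R^-1 *: \sum_(l < k) z l)| <= N * e.
    by rewrite (le_trans (TN _))// ler_wpM2l.
  rewrite linearB/= meanE hphi -scalerBl normrZ; apply: le_trans.
  by rewrite ler_pM2r// (le_trans _ (ler_norm _))// lerD2l lerN2.
have hi2 : phi (z i) * `|w| <= N.
  have : `|T (z i)| <= N by rewrite (le_trans (TN _))// ler_piMr.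
  rewrite hphi normrZ; apply: le_trans; rewrite ler_pM2r//; exact: ler_norm.
have Ty : `|T y| = phi y * `|w| by rewrite hphi normrZ ger0_norm.
have dist : `|T (z i) - T y| <= N * e + 2 * e.
  rewrite !hphi -scalerBl normrZ; have e2 : 0 <= e by exact: ltW.
  have Ne : 0 <= N * e by rewrite mulr_ge0.
  rewrite -[X in _ * X]normr_id -normrM ler_norml mulrBl; rewrite mulrBl in lo.
  lra.
have : `|z i + T (z i)| <= operator_norm (idfun \+ T).
  by apply: sup_upper_bound => //; exists (z i).
have : `|T y + z i| <= `|z i + T (z i)| + `|T (z i) - T y|.
  have -> : T y + z i = (z i + T (z i)) - (T (z i) - T y).
    by rewrite opprB addrA addrAC addrK addrC.
  exact: ler_normB.
lra.
Qed.

End daugavet_criterion.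

(** * The Daugavet property of the sequence space *)

Section poly_daugavet.
Context (R : realType).
Local Notation rho := (@poly_norm R).
Implicit Types (v x : {poly R}).

Lemma injective_unbounded (f : nat -> nat) N : injective f -> exists m, (N <= f m)%N.
Proof.
move=> fI; apply: contrapT => h.
have lt m : (f m < N)%N by rewrite ltnNge; apply/negP => le; apply: h; exists m.
have gI : injective (fun i : 'I_N.+1 => Ordinal (lt i)).
  by move=> i i' /(congr1 val)/= /fI/val_inj.
by have := leq_card _ gI; rewrite !card_ord ltnn.
Qed.

(** Infinitely many stages treat q. *)
Lemma node_rational (q : {poly rat}) N : rho (map_poly ratr q) <= 1 ->
  exists2 n, (N <= n)%N & node R n = map_poly ratr q.
Proof.
set p := map_poly ratr q => p1.
have fI : injective (fun m : nat => pickle (m, q)).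
  by move=> m m' /(pcan_inj pickleK)[].
have [m hm] := injective_unbounded (maxn N (size p)) fI.
move: hm; rewrite geq_max => /andP[hN hs].
exists (pickle (m, q)) => //; rewrite /node /target /candidate pickleK/= -/p.
have sp : (size p <= dimen (pickle (m, q)))%N by rewrite (leq_trans hs)// dimen_ge.
case: asboolP => // -[]; split=> // phi Dphi.
exact: le_trans (pairing_le_norm sp Dphi) p1.
Qed.

Lemma poly_daugavet_means x v e : rho v < 1 -> 0 < e ->
  exists (k : nat) (z : nat -> {poly R}),
    [/\ (0 < k)%N,
        forall i, (i < k)%N -> rho (z i) <= 1 /\ rho x + 1 <= rho (x + z i)
      & rho (v - k%:R^-1 *: \sum_(i < k) z i) <= e].
Proof.
move=> v1 e0; have e2 : 0 < e / 2 by rewrite divr_gt0.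
have [q [_ _ q1 hq]] := rational_ball_approx v1 e2.
have e6 : 0 < e / 6 by rewrite divr_gt0.
pose b := Num.trunc (e / 6)^-1.
have [n nN nq] := node_rational (maxn b (size x)) q1.
move: nN; rewrite geq_max => /andP[bn xn].
have wn : weight R n <= e / 6.
  rewrite -[leRHS]invrK lef_pV2 ?posrE ?invr_gt0// (le_trans (ltW (truncnS_gt _)))//.
  by rewrite ler_nat.
exists (width n), (fun i => 'X^(dimen n + i)); split; first exact: width_gt0.
  move=> i ik; split; first exact: poly_norm_Xn_le1.
  by apply: poly_norm_add_new => //; rewrite (leq_trans xn)// dimen_ge.
set a := _ *: _; have -> : v - a = (v - node R n) + (node R n - a).
  by rewrite addrA subrK.
rewrite (le_trans (poly_normD _ _))//.
have := poly_norm_node_mean R n; rewrite -/a nq; lra.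
Qed.

Context (W : normedModType R) (j : {poly R} -> W).
Hypothesis j_lin : forall a x v, j (a *: x + v) = a *: j x + j v.
Hypothesis j_norm : forall x, `|j x| = rho x.
Hypothesis j_dense : forall q e, 0 < e -> exists x, `|q - j x| < e.

Lemma isometryD x v : j (x + v) = j x + j v.
Proof. by have := j_lin 1 x v; rewrite !scale1r. Qed.

Lemma isometry0 : j 0 = 0.
Proof.
by apply/eqP; rewrite -normr_eq0 j_norm poly_norm0.
Qed.

Lemma isometryZ a x : j (a *: x) = a *: j x.
Proof. by have := j_lin a x 0; rewrite isometry0 !addr0. Qed.

Lemma isometryB x v : j (x - v) = j x - j v.
Proof. by rewrite -scaleN1r isometryD isometryZ scaleN1r. Qed.

Lemma isometry_sum (I : Type) (r : seq I) (F : I -> {poly R}) :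
  j (\sum_(i <- r) F i) = \sum_(i <- r) j (F i).
Proof. by apply: big_morph; [exact: isometryD|exact: isometry0]. Qed.

(** The means of [poly_daugavet_means] are carried to W through the dense
    isometric image. *)
Lemma isometry_daugavet : daugavet_property W.
Proof.
apply: daugavet_of_means => x y e y1 e0.
have [x' hx] : exists x', `|x - j x'| < e / 2 by apply: j_dense; rewrite divr_gt0.
pose d := Num.min (e / 2) (1 - `|y|).
have d0 : 0 < d by rewrite lt_min divr_gt0//= subr_gt0.
have [y' hy] := j_dense y d0.
have de : d <= e / 2 by rewrite ge_min lexx.
have d1 : d <= 1 - `|y| by rewrite ge_min lexx orbT.
have y'1 : rho y' < 1.
  by rewrite -j_norm; have := ler_normB y (y - j y'); rewrite subKr; lra.
have e2 : 0 < e / 2 by rewrite divr_gt0.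
have [k [z [k0 hz hm]]] := poly_daugavet_means x' y'1 e2.
exists k, (fun i => j (z i)); split=> // [i ik|].
  have [z1 hz2] := hz i ik; rewrite j_norm; split=> //.
  rewrite -!j_norm isometryD in hz2.
  have := ler_normB x (x - j x'); rewrite subKr => h1.
  have h2 := ler_normD (x + j (z i)) (j x' - x).
  have e3 : x + j (z i) + (j x' - x) = j x' + j (z i) by rewrite addrC addrA subrK.
  rewrite e3 (distrC (j x')) in h2.
  have := ler_normD (j x') (x - j x'); rewrite addrC subrK; lra.
rewrite -isometry_sum -isometryZ; set a := _ *: _ in hm *.
have -> : y - j a = (y - j y') + (j y' - j a) by rewrite addrA subrK.
rewrite (le_trans (ler_normD _ _))// -isometryB j_norm; lra.
Qed.

Lemma isometry_neq0 : exists q : W, q != 0.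
Proof.
exists (j 'X^0); rewrite -normr_eq0 j_norm gt_eqF//.
have := @poly_norm_add_new R 0 0 0; rewrite poly_norm0 !add0r size_poly0.
have -> : dimen 0 = 0%N by rewrite /dimen big_ord0.
move=> /(_ (leq0n _) (width_gt0 0)).
exact: lt_le_trans.
Qed.

End poly_daugavet.

(** * Integration of classes in L1 *)

Section L1_space.
Context d (T : measurableType d) (R : realType) (mu : {measure set T -> \bar R}).
Local Notation L := (LspaceType1 mu).
Implicit Types (f h : L) (F : T -> R) (D : set T).

Lemma L1_integrable f : mu.-integrable [set: T] (EFin \o (f : T -> R)).
Proof. exact/Lfun1_integrable/Lspace_repr_subproof. Qed.

Lemma L1_integrableS f D : measurable D -> mu.-integrable D (EFin \o (f : T -> R)).
Proof. by move=> mD; exact: integrableS (L1_integrable f). Qed.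

Lemma L1_normE f : `|f| = \int[mu]_x `|(f : T -> R) x|.
Proof.
rewrite -[`|f|]/(Lspace_norm f) /Lspace_norm Lnorm1.
by congr fine; apply: eq_integral.
Qed.

(** The operations of L1 are those of representatives. *)
Lemma L1_lin_ae a f h :
  ((a *: f + h : L) : T -> R) = (fun x => a * (f : T -> R) x + (h : T -> R) x) %[ae mu].
Proof.
rewrite -[a *: f + h]/(Lspace_add (Lspace_scale a f) h) /Lspace_add.
apply: ae_eq_trans (Lfun_classK _) _.
have e1 : (Lspace_repr (Lspace_scale a f) : T -> R) =
    (fun x => a * (f : T -> R) x) %[ae mu] by exact: Lfun_classK.
by apply: filterS e1 => x /= ex Dx; exact: (congr1 (fun y => y + (h : T -> R) x) (ex Dx)).
Qed.

Lemma L1_class_exists F : mu.-integrable [set: T] (EFin \o F) ->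
  exists f, (f : T -> R) = F %[ae mu].
Proof.
move=> iF; have FL : F \in Lfun mu 1 by apply/Lfun1_integrable.
by exists (Lfun_class (Lfun_Sub (lexx 1%E) FL)); exact: Lfun_classK.
Qed.

Lemma ae_eq_Rintegral D F G : measurable D ->
  measurable_fun [set: T] F -> measurable_fun [set: T] G -> F = G %[ae mu] ->
  \int[mu]_(x in D) F x = \int[mu]_(x in D) G x.
Proof.
move=> mD mF mG FG; congr fine; apply: ae_eq_integral => //.
- by apply/measurable_EFinP; exact: measurable_funTS.
- by apply/measurable_EFinP; exact: measurable_funTS.
- by apply: filterS FG => x /= /(_ Logic.I) ->.
Qed.

Lemma L1_measurable f : measurable_fun [set: T] (f : T -> R).
Proof. exact: measurable_aeEqMfun. Qed.

Lemma L1_Rintegral_lin D a f h : measurable D ->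
  \int[mu]_(x in D) (a *: f + h : L) x =
  a * \int[mu]_(x in D) (f : T -> R) x + \int[mu]_(x in D) (h : T -> R) x.
Proof.
move=> mD; rewrite (ae_eq_Rintegral mD _ _ (L1_lin_ae a f h)).
- rewrite RintegralD ?RintegralZl//; try exact: L1_integrableS.
  exact: (integrableZl mD a (L1_integrableS f mD)).
- exact: L1_measurable.
- apply: measurable_funD; last exact: L1_measurable.
  by apply: measurable_funM => //; exact: L1_measurable.
Qed.

End L1_space.

Section L1_partition.
Context d (T : measurableType d) (R : realType) (mu : {measure set T -> \bar R}).
Variable I : nat -> set T.
Hypothesis mI : forall n, measurable (I n).
Hypothesis tI : trivIset setT I.
Hypothesis UI : \bigcup_n I n = setT.
Hypothesis I_gt0 : forall n, (0 < mu (I n))%E.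
Hypothesis I_fin : forall n, (mu (I n) < +oo)%E.
Local Notation L := (LspaceType1 mu).
Implicit Types (f h : L).

Let a f n := \int[mu]_(x in I n) `|(f : T -> R) x|.

Let a_ge0 f n : 0 <= a f n. Proof. exact: Rintegral_ge0. Qed.

Let aE f n : (a f n)%:E = (\int[mu]_(x in I n) `|(f : T -> R) x|%:E)%E.
Proof.
rewrite /a /Rintegral fineK// fin_num_abs.
have /integrableP[_] := integrable_abse (L1_integrableS f (mI n)).
rewrite gee0_abs ?integral_ge0//.
by under eq_integral do rewrite /= normr_id.
Qed.

Lemma L1_norm_series f : (\sum_(n < N) a f n) @[N --> \oo] --> `|f|.
Proof.
have := L1_integrable f => /integrableP[mf foo].
have mf' : measurable_fun [set: T] (fun x => `|(f : T -> R) x|%:E).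
  by apply/measurable_EFinP; apply: measurableT_comp => //; exact: L1_measurable.
have e1 : (`|f|)%:E = (\int[mu]_x `|(f : T -> R) x|%:E)%E.
  by rewrite L1_normE /Rintegral fineK// ge0_fin_numE// integral_ge0.
have e2 : (\int[mu]_x `|(f : T -> R) x|%:E)%E =
    (\big[+%E/0]_(0 <= n <oo) (a f n)%:E)%E.
  rewrite -[in LHS]UI ge0_integral_bigcup// ?UI//.
  by apply: eq_eseriesr => n _; rewrite aE.
have c : ((\sum_(0 <= n < N) (a f n)%:E)%E @[N --> \oo] --> (`|f|)%:E)%classic.
  rewrite e1 e2; apply: is_cvg_nneseries => n _ _; rewrite lee_fin.
  exact: a_ge0.
move/fine_cvg: c; apply: cvg_trans; apply: near_eq_cvg; near=> N.
by rewrite /= sumEFin big_mkord.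
Unshelve. all: by end_near. Qed.

Lemma L1_partial_le_norm N f : \sum_(n < N) a f n <= `|f|.
Proof.
have c := @L1_norm_series f.
rewrite -(cvg_lim _ c)//; apply: nondecreasing_cvgn_le; last by apply/cvg_ex; exists `|f|.
apply/nondecreasing_seqP => n; rewrite big_ord_recr/= lerDl.
exact: a_ge0.
Qed.

Lemma L1_coef_sum N f :
  \sum_(n < N) `|\int[mu]_(x in I n) (f : T -> R) x| <= `|f|.
Proof.
apply: le_trans (L1_partial_le_norm N f); apply: ler_sum => n _.
by apply: le_normr_Rintegral => //; exact: L1_integrableS.
Qed.

Lemma L1_bump n : exists g : L, `|g| <= 1 /\
  forall m, \int[mu]_(x in I m) (g : T -> R) x = (m == n)%:R.
Proof.
have fin : mu (I n) \is a fin_num by rewrite ge0_fin_numE.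
have pos : 0 < fine (mu (I n)) by rewrite fine_gt0// I_gt0/=.
pose c : R := (fine (mu (I n)))^-1; have c0 : 0 < c by rewrite invr_gt0.
pose F := (fun _ : T => c) \_ (I n).
have iF : mu.-integrable [set: T] (EFin \o F).
  rewrite -restrict_EFin; apply: (integrable_mkcond _ (mI n)).1; apply/integrableP; split.
    by apply/measurable_EFinP; exact: measurable_cst.
  under eq_integral do rewrite /=.
  by rewrite integral_cst// lte_mul_pinfty.
have [g gF] := L1_class_exists iF.
have mF : measurable_fun [set: T] F.
  by apply/measurable_EFinP; have /integrableP[] := iF.
have Fint (c' : R) D : measurable D ->
    \int[mu]_(x in D) ((fun _ : T => c') \_ (I n)) x = c' * fine (mu (D `&` I n)).
  by move=> mD; rewrite -Rintegral_mkcondr Rintegral_cst//; exact: measurableI.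
exists g; split.
  rewrite L1_normE (@ae_eq_Rintegral _ _ _ _ _ _ (fun x => `|F x|))//; last 3 first.
  - apply: measurableT_comp => //; exact: L1_measurable.
  - exact: measurableT_comp.
  - by apply: filterS gF => x /= /[apply] ->.
  rewrite (@eq_Rintegral _ _ _ _ _ F) ?Fint// ?setTI ?mulVf ?gt_eqF//.
  by move=> x _; rewrite /F patchE; case: ifP => _; rewrite ?normr0// gtr0_norm.
move=> m; rewrite (ae_eq_Rintegral (mI m) (L1_measurable g) mF gF) Fint//.
have [->|mn] := eqVneq m n; first by rewrite setIid mulVf// gt_eqF.
by move/trivIsetP : tI => ->//; rewrite measure0 mulr0.
Qed.

(** The tail f' is f cut off to the first N pieces; its distance to f is
    the remainder of the series of [L1_norm_series]. *)
Lemma L1_tail f e : 0 < e -> exists N (f' : L), `|f - f'| < e /\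
  forall n, (N <= n)%N -> \int[mu]_(x in I n) (f' : T -> R) x = 0.
Proof.
move=> e0; have /cvgrPdist_lt/(_ _ e0)[N _ hN] := @L1_norm_series f.
pose U := \bigcup_(n in [set n | (n < N)%N]) I n.
have mU : measurable U by apply: bigcup_measurable => n _.
have UE x n : I n x -> (x \in U) = (n < N)%N.
  move=> Ix; apply/idP/idP => [/set_mem[m /= mN Imx]|nN]; last by apply/mem_set; exists n.
  have [->//|mn] := eqVneq n m.
  move/trivIsetP : tI => /(_ n m Logic.I Logic.I mn) h.
  by have : (I n `&` I m) x by []; rewrite h.
have iF : mu.-integrable [set: T] (EFin \o ((f : T -> R) \_ U)).
  by rewrite -restrict_EFin; apply: (integrable_mkcond _ mU).1; exact: L1_integrableS.
have [f' fF] := L1_class_exists iF.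
have mF : measurable_fun [set: T] ((f : T -> R) \_ U).
  by apply/measurable_EFinP; have /integrableP[] := iF.
exists N, f'; split; last first.
  move=> n Nn; rewrite (ae_eq_Rintegral (mI n) (L1_measurable f') mF fF).
  rewrite (@eq_Rintegral _ _ _ _ _ (cst 0)) ?Rintegral_cst ?mul0r//.
  by move=> x /set_mem Ix; rewrite patchE (UE _ _ Ix) ltnNge Nn.
have aN n : a (f - f') n = if (n < N)%N then 0 else a f n.
  pose G x := `|(f : T -> R) x - ((f : T -> R) \_ U) x|.
  have -> : a (f - f') n = \int[mu]_(x in I n) G x.
    apply: ae_eq_Rintegral => //.
    - by apply: measurableT_comp => //; exact: L1_measurable.
    - apply: measurableT_comp => //; apply: measurable_funB => //; exact: L1_measurable.
    - have -> : f - f' = (-1) *: f' + f by rewrite scaleN1r addrC.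
      apply: filterS2 (L1_lin_ae (-1) f' f) fF => x h1 h2 Dx.
      by rewrite (h1 Dx) /G -(h2 Dx) mulN1r addrC.
  case: ifPn => nN.
    rewrite (@eq_Rintegral _ _ _ _ _ (cst 0)) ?Rintegral_cst ?mul0r// => x /set_mem Ix.
    by rewrite /G patchE (UE _ _ Ix) nN subrr normr0.
  apply: eq_Rintegral => x /set_mem Ix.
  by rewrite /G patchE (UE _ _ Ix) (negPf nN) subr0.
have c := @L1_norm_series (f - f').
have c' : (\sum_(n < M) a (f - f') n) @[M --> \oo] --> `|f| - \sum_(n < N) a f n.
  apply: (cvg_trans _ (cvgB (@L1_norm_series f) (@cvg_cst R^o (\sum_(n < N) a f n) nat \oo _))).
  apply: near_eq_cvg; near=> M.
  have NM : (N <= M)%N by near: M; exists N.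
  rewrite /= fctE -!(big_mkord xpredT) (big_cat_nat (n := N))//= addrAC subrr add0r.
  have z : \sum_(0 <= n < N) a (f - f') n = 0.
    by rewrite big_nat big1// => n /andP[_ nN]; rewrite aN nN.
  rewrite [RHS](big_cat_nat (n := N))//= z add0r.
  by apply: eq_big_nat => n /andP[Nn _]; rewrite aN ltnNge Nn.
rewrite (cvg_unique _ c c')//.
by rewrite (le_lt_trans (ler_norm _))// hN/=.
Unshelve. all: by end_near. Qed.

End L1_partition.

(** * Signed sums of orthogonal functions in L1 *)

Section orthogonal_sums.
Context d (T : measurableType d) (R : realType) (mu : {measure set T -> \bar R}).
Hypothesis muT : (mu [set: T] < +oo)%E.
Variable r : nat -> T -> R.
Hypothesis mr : forall m, measurable_fun [set: T] (r m).
Hypothesis r_le1 : forall m x, `|r m x| <= 1.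
Hypothesis r_ortho : forall m l, \int[mu]_x (r m x * r l x) = (m == l)%:R / 2.
Local Notation L := (LspaceType1 mu).

Let bounded_integrable (F : T -> R) M : measurable_fun [set: T] F ->
  (forall x, `|F x| <= M) -> mu.-integrable [set: T] (EFin \o F).
Proof.
move=> mF FM; apply: measurable_bounded_integrable => //.
exists M; split; first by rewrite num_real.
by move=> y My x _; apply: le_trans (FM x) (ltW My).
Qed.

Variable eps : nat -> R.
Hypothesis eps1 : forall m, eps m ^+ 2 = 1.

Let eps_norm m : `|eps m| = 1.
Proof. by apply/eqP; rewrite -sqrp_eq1// -normrX eps1 normr1. Qed.

Definition signed_sum (s : seq nat) x : R := \sum_(m <- s) eps m * r m x.

Let signed_cons m s x : signed_sum (m :: s) x = eps m * r m x + signed_sum s x.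
Proof. exact: big_cons. Qed.

Let measurable_signed s : measurable_fun [set: T] (signed_sum s).
Proof.
elim: s => [|m s IH].
  rewrite (_ : signed_sum [::] = cst 0)//.
  by apply/funext => x; rewrite /signed_sum big_nil.
rewrite (_ : signed_sum (m :: s) = fun x => eps m * r m x + signed_sum s x).
  by apply: measurable_funD => //; apply: measurable_funM.
by apply/funext => x; exact: signed_cons.
Qed.

Let signed_le s x : `|signed_sum s x| <= (size s)%:R.
Proof.
elim: s => [|m s IH]; first by rewrite /signed_sum big_nil normr0.
rewrite signed_cons (le_trans (ler_normD _ _))//= -natr1 addrC lerD//.
by rewrite normrM eps_norm mul1r.
Qed.

Let integrable_mulr m s : mu.-integrable [set: T] (EFin \o (fun x => r m x * signed_sum s x)).
Proof.
apply: (@bounded_integrable _ (size s)%:R); first exact: measurable_funM.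
by move=> x; rewrite normrM -[leRHS]mul1r ler_pM.
Qed.

Let integrable_rr m l : mu.-integrable [set: T] (EFin \o (fun x => r m x * r l x)).
Proof.
apply: (@bounded_integrable _ 1); first exact: measurable_funM.
by move=> x; rewrite normrM -[leRHS]mul1r ler_pM.
Qed.

Let integrable_sqr s : mu.-integrable [set: T] (EFin \o (fun x => signed_sum s x ^+ 2)).
Proof.
apply: (@bounded_integrable _ ((size s)%:R ^+ 2)); first exact: measurable_funX.
by move=> x; rewrite normrX lerXn2r// nnegrE.
Qed.

Let integral_mulr_notin m s : m \notin s -> \int[mu]_x (r m x * signed_sum s x) = 0.
Proof.
elim: s => [_|l s IH].
  under [LHS]eq_Rintegral do rewrite /signed_sum big_nil mulr0.
  by rewrite Rintegral_cst// mul0r.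
rewrite in_cons negb_or => /andP[/negPf ml /IH h].
under [LHS]eq_Rintegral do rewrite signed_cons mulrDr mulrCA.
rewrite RintegralD//; last exact: (integrableZl _ (eps l) (integrable_rr m l)).
by rewrite h RintegralZl// r_ortho ml mul0r mulr0 addr0.
Qed.

(** Orthogonality: the cross terms vanish. *)
Lemma integral_signed_sqr s : uniq s ->
  \int[mu]_x (signed_sum s x ^+ 2) = (size s)%:R / 2.
Proof.
elim: s => [_|m s IH /= /andP[ms us]].
  under [LHS]eq_Rintegral do rewrite /signed_sum big_nil expr0n.
  by rewrite Rintegral_cst// !mul0r.
have -> : \int[mu]_x (signed_sum (m :: s) x ^+ 2) =
    \int[mu]_x (r m x * r m x + (2 * eps m * (r m x * signed_sum s x) + signed_sum s x ^+ 2)).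
  apply: eq_Rintegral => x _; rewrite signed_cons sqrrD exprMn eps1 mul1r expr2.
  by rewrite -[in LHS]addrA; congr (_ + (_ + _)); rewrite -mulr_natl; ring.
have i1 : mu.-integrable [set: T]
    (EFin \o (fun x => 2 * eps m * (r m x * signed_sum s x))).
  exact: (integrableZl _ (2 * eps m) (integrable_mulr m s)).
rewrite RintegralD//; last exact: (integrableD _ i1 (integrable_sqr s)).
rewrite RintegralD// RintegralZl// integral_mulr_notin// mulr0 add0r IH// r_ortho eqxx.
by rewrite /= -[in RHS]natr1 mulrDl addrC.
Qed.

(** A form of the Cauchy-Schwarz inequality without square roots: integrate
    (|S| - t)^2 >= 0. *)
Lemma integral_norm_signed_le s t : uniq s ->
  2 * t * (\int[mu]_x `|signed_sum s x|) <= (size s)%:R / 2 + t ^+ 2 * fine (mu [set: T]).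
Proof.
move=> us; rewrite -integral_signed_sqr//.
have i1 : mu.-integrable [set: T] (EFin \o (fun x => `|signed_sum s x|)).
  apply: (@bounded_integrable _ (size s)%:R); first exact: measurableT_comp.
  by move=> x; rewrite normr_id.
have i2 : mu.-integrable [set: T] (EFin \o (fun=> t ^+ 2)).
  by apply: (@bounded_integrable _ `|t ^+ 2|).
rewrite -RintegralZl// -Rintegral_cst// -RintegralD//.
apply: le_Rintegral => //.
- exact: (integrableZl _ (2 * t) i1).
- exact: (integrableD _ (integrable_sqr s) i2).
- move=> x _; rewrite -[signed_sum s x ^+ 2]real_normK ?num_real//.
  by have := sqr_ge0 (`|signed_sum s x| - t); nra.
Qed.

(** As |S| <= size s, the integral of S^2 is at most size s times that of
    |S|. *)
Lemma integral_norm_signed_ge s : uniq s ->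
  1 / 2 <= \int[mu]_x `|signed_sum s x| \/ s = [::].
Proof.
move=> us; case: s us => [|m s] us; [by right|left].
have i1 : mu.-integrable [set: T] (EFin \o (fun x => `|signed_sum (m :: s) x|)).
  apply: (@bounded_integrable _ (size (m :: s))%:R); first exact: measurableT_comp.
  by move=> x; rewrite normr_id.
have s0 : 0 < (size (m :: s))%:R :> R by rewrite ltr0n.
have : \int[mu]_x (signed_sum (m :: s) x ^+ 2) <=
    \int[mu]_x ((size (m :: s))%:R * `|signed_sum (m :: s) x|).
  apply: le_Rintegral => //; first exact: (integrableZl _ (size (m :: s))%:R i1).
  move=> x _; rewrite -[signed_sum _ x ^+ 2]real_normK ?num_real// expr2.
  by rewrite ler_wpM2r.
by rewrite RintegralZl// integral_signed_sqr// ler_pM2l// mul1r.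
Qed.

Variable f : nat -> L.
Hypothesis f_ae : forall m, (f m : T -> R) = r m %[ae mu].

Lemma signed_sum_ae s :
  ((\sum_(m <- s) eps m *: f m : L) : T -> R) = signed_sum s %[ae mu].
Proof.
elim: s => [|m s IH].
  rewrite big_nil; have := L1_lin_ae (-1) (0 : L) 0; rewrite scaler0 addr0.
  apply: filterS => x h Dx; rewrite (h Dx) /signed_sum big_nil.
  by rewrite mulN1r addNr.
rewrite big_cons; apply: filterS3 (L1_lin_ae (eps m) (f m) (\sum_(m <- s) eps m *: f m)) (f_ae m) IH.
by move=> x h1 h2 h3 Dx; rewrite (h1 Dx) (h2 Dx) (h3 Dx) signed_cons.
Qed.

Lemma signed_sum_normE s :
  `|\sum_(m <- s) eps m *: f m| = \int[mu]_x `|signed_sum s x|.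
Proof.
rewrite L1_normE; apply: ae_eq_Rintegral => //.
- by apply: measurableT_comp => //; exact: L1_measurable.
- exact: measurableT_comp.
- by apply: filterS (signed_sum_ae s) => x h Dx; rewrite (h Dx).
Qed.

End orthogonal_sums.

(** * The unit interval *)

Section unit_interval.
Context (R : realType).
Local Notation leb := (@lebesgue_measure R).
Local Notation unit_measure := (mrestr leb (measurable_itv `[0%R : R, 1%R])).

Lemma unit_measureT : unit_measure [set: R] = 1%E.
Proof.
rewrite /mrestr setTI lebesgue_measure_itv/= lte_fin ltr01.
by rewrite oppr0 adde0.
Qed.

Definition wave k (x : R) : R := cos (k%:R * pi * x).

Lemma continuous_wave k : continuous (wave k).
Proof.
move=> x; apply: continuous_comp; last exact: continuous_cos.
exact: mulrl_continuous.
Qed.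

Lemma measurable_wave k : measurable_fun [set: R] (wave k).
Proof. exact: continuous_measurable_fun (@continuous_wave k). Qed.

Lemma wave_le1 k x : `|wave k x| <= 1.
Proof. by rewrite ler_norml cos_geN1 cos_le1. Qed.

(** The two truncated differences add up to the distance of k and l. *)
Lemma waveM k l x :
  wave k x * wave l x = (wave (k + l) x + wave ((k - l) + (l - k)) x) / 2.
Proof.
wlog lk : k l / (l <= k)%N.
  move=> H; have [lk|kl] := leqP l k; first exact: H.
  by rewrite mulrC (H l k) ?(ltnW kl)// addnC [(l - k + _)%N]addnC.
have -> : ((k - l) + (l - k) = k - l)%N by rewrite (eqP lk) addn0.
rewrite /wave natrD natrB// !mulrBl !mulrDl cosD cosB; lra.
Qed.

Lemma sin_natpi k : sin (k%:R * pi) = 0 :> R.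
Proof.
elim: k => [|k IH]; first by rewrite mul0r sin0.
by rewrite -natr1 mulrDl mul1r sinDpi IH oppr0.
Qed.

Lemma Rintegral_unit_measure (F : R -> R) :
  unit_measure.-integrable [set: R] (EFin \o F) ->
  \int[unit_measure]_x F x = \int[leb]_(x in `[0, 1]) F x.
Proof.
move=> iF; rewrite /Rintegral; congr fine.
have mN : measurable (~` `[0%R : R, 1%R] : set (measurableTypeR R)).
  by apply: measurableC; exact: measurable_itv.
have N0 : unit_measure (~` `[0%R : R, 1%R]) = 0%E by rewrite /mrestr setICl measure0.
have /= := negligible_integral mN (@measurableT _ (measurableTypeR R)) iF N0; rewrite /comp => ->.
rewrite setTD setCK; apply: eq_measure_integral => A mA AD.
by rewrite /= /mrestr setIidl.
Qed.

Lemma integrable_wave k : unit_measure.-integrable [set: R] (EFin \o wave k).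
Proof.
apply: measurable_bounded_integrable => //.
- by rewrite [X in (X < _)%E]unit_measureT ltry.
- exact: measurable_wave.
- exists 1; split; first by rewrite num_real.
  by move=> y y1 x _; apply: le_trans (wave_le1 k x) (ltW y1).
Qed.

Lemma integral_wave k : (0 < k)%N -> \int[unit_measure]_x wave k x = 0.
Proof.
move=> k0; rewrite Rintegral_unit_measure; last exact: integrable_wave.
have c0 : k%:R * pi != 0 :> R by rewrite mulf_neq0 ?pnatr_eq0 -?lt0n// gt_eqF// pi_gt0.
pose F (x : R) := (k%:R * pi)^-1 * sin (k%:R * pi * x).
have dF (x : R) : is_derive x 1 F (wave k x).
  rewrite /F /wave; apply: is_derive_eq.
  by rewrite /GRing.scale/= mulr1 mulrCA mulVf// mulr1.
have cF : continuous F.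
  by move=> x; apply: differentiable_continuous; apply/derivable1_diffP; case: (dF x).
rewrite /Rintegral (@continuous_FTC2 _ _ F)//.
- by rewrite /F mulr1 mulr0 sin0 sin_natpi !mulr0 subee.
- by apply: continuous_subspaceT; exact: continuous_wave.
- split; first by move=> x _; case: (dF x).
  + by apply: cvg_at_right_filter; exact: cF.
  + by apply: cvg_at_left_filter; exact: cF.
- by move=> x _; rewrite derive1E; exact: derive_val.
Qed.

Lemma integral_waveM m l :
  \int[unit_measure]_x (wave m.+1 x * wave l.+1 x) = (m == l)%:R / 2.
Proof.
under eq_Rintegral do rewrite waveM mulrC.
rewrite RintegralZl//; last exact: (integrableD _ (integrable_wave _) (integrable_wave _)).
rewrite RintegralD//; try exact: integrable_wave.
rewrite integral_wave// add0r mulrC; congr (_ / _).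
have [->|ml] := eqVneq m l.
  rewrite subnn addn0 /wave.
  under eq_Rintegral do rewrite !mul0r cos0.
  by rewrite Rintegral_cst// mul1r [X in fine X]unit_measureT.
rewrite integral_wave//.
by rewrite addn_gt0 !subn_gt0 !ltnS; case: ltngtP ml.
Qed.

(** The complements of ]0, 1/(n+2)] increase to the whole line, so their
    differences partition it, and each of them contains the interval
    ]1/(n+2), 1/(n+1)]. *)
Definition shell_cover n : set R := ~` `]0%R, n.+2%:R^-1%R].
Definition shell : nat -> set R := seqDU shell_cover.

Lemma measurable_shell n : measurable (shell n).
Proof.
apply: measurableD; first exact: measurableC.
by apply: bigsetU_measurable => i _; exact: measurableC.
Qed.

Lemma bigcup_shell : \bigcup_n shell n = [set: R].
Proof.
rewrite -seqDU_bigcup_eq; apply/seteqP; split=> // x _.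
have [x0|x0] := leP x 0.
  by exists 0%N => //; rewrite /shell_cover/= in_itv/= ltNge x0.
exists (Num.trunc x^-1) => //; rewrite /shell_cover/= in_itv/= x0/=; apply/negP; rewrite -ltNge.
rewrite -[ltRHS]invrK ltf_pV2 ?posrE ?invr_gt0//.
by rewrite (lt_le_trans (truncnS_gt _))// ler_nat.
Qed.

Lemma unit_measure_shell_gt0 n : (0 < unit_measure (shell n))%E.
Proof.
have lt12 : n.+2%:R^-1 < n.+1%:R^-1 :> R by rewrite ltf_pV2 ?posrE// ltr_nat.
apply: (@lt_le_trans _ _ (leb `]n.+2%:R^-1, n.+1%:R^-1])).
  by rewrite lebesgue_measure_itv/= lte_fin lt12 -EFinD lte_fin subr_gt0.
apply: le_measure; rewrite ?inE//.
  by apply: measurableI => //; exact: measurable_shell.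
move=> x /=; rewrite !in_itv/= => /andP[x1 x2].
have x0 : 0 < x by apply: lt_trans x1; rewrite invr_gt0.
have xn1 : x <= 1 by rewrite (le_trans x2)// invf_le1// ler1n.
split; last by rewrite (ltW x0).
split; first by rewrite /shell_cover/= in_itv/= x0/= leNgt x1.
rewrite -bigcup_mkord => -[i /= iN]; rewrite /shell_cover/= in_itv/= x0/=.
by apply; rewrite (le_trans x2)// lef_pV2 ?posrE// ler_nat.
Qed.

Lemma unit_measure_fin (A : set R) : measurable A -> (unit_measure A < +oo)%E.
Proof.
move=> mA; apply: (@le_lt_trans _ _ (unit_measure [set: R])); last first.
  by rewrite unit_measureT ltry.
by apply: le_measure; rewrite ?inE//.
Qed.

End unit_interval.

(** * No isomorphic copy of L1 *)

Section isomorphic_copies.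
Context (R : realType).
Local Notation unit_measure :=
  (mrestr (@lebesgue_measure R) (measurable_itv `[0%R : R, 1%R])).

Lemma subr_interchange (U : zmodType) (a b x y : U) :
  (a - b) - (x - y) = (a - x) - (b - y).
Proof. by rewrite opprD addrACA -opprD. Qed.

Lemma unit_measure_lty : (unit_measure [set: R] < +oo)%E.
Proof. by rewrite [X in (X < _)%E]unit_measureT ltry. Qed.

Lemma L1_wave_exists : exists f : nat -> L1 R,
  forall m, ((f m : LspaceType1 unit_measure) : R -> R) = @wave R m.+1 %[ae unit_measure].
Proof.
have /choice[f hf] : forall m, exists g : LspaceType1 unit_measure,
    (g : R -> R) = @wave R m.+1 %[ae unit_measure].
  by move=> m; apply: L1_class_exists; exact: integrable_wave.
by exists f.
Qed.

Lemma L1_wave_sums (f : nat -> L1 R) :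
  (forall m, ((f m : LspaceType1 unit_measure) : R -> R) = @wave R m.+1 %[ae unit_measure]) ->
  forall s1 s2 (t : R), uniq (s1 ++ s2) ->
  2 * t * `|\sum_(m <- s1) f m - \sum_(m <- s2) f m| <=
    (size (s1 ++ s2))%:R / 2 + t ^+ 2 /\
  (s1 != [::] -> 1 / 2 <= `|\sum_(m <- s1) f m - \sum_(m <- s2) f m|).
Proof.
move=> hf s1 s2 t us; pose eps m : R := if m \in s1 then 1 else -1.
have eps1 m : eps m ^+ 2 = 1 by rewrite /eps; case: ifP => _; rewrite ?sqrrN expr1n.
have -> : \sum_(m <- s1) f m - \sum_(m <- s2) f m = \sum_(m <- s1 ++ s2) eps m *: f m.
  rewrite big_cat/= -sumrN; congr (_ + _).
    by apply: eq_big_seq => m ms; rewrite /eps ms scale1r.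
  apply: eq_big_seq => m ms; rewrite /eps ifF ?scaleN1r//.
  apply/negbTE; move: us; rewrite cat_uniq => /and3P[_ /hasPn h _].
  exact: h.
have nE := @signed_sum_normE _ _ _ unit_measure (fun m => @wave R m.+1)
  (fun m => @measurable_wave R m.+1) eps f hf (s1 ++ s2).
have b1 := @integral_norm_signed_le _ _ _ unit_measure unit_measure_lty
  (fun m => @wave R m.+1) (fun m => @measurable_wave R m.+1)
  (fun m => @wave_le1 R m.+1) (@integral_waveM R) eps eps1 (s1 ++ s2) t us.
have b2 := @integral_norm_signed_ge _ _ _ unit_measure unit_measure_lty
  (fun m => @wave R m.+1) (fun m => @measurable_wave R m.+1)
  (fun m => @wave_le1 R m.+1) (@integral_waveM R) eps eps1 (s1 ++ s2) us.
split.
  by have := b1; rewrite [X in fine X]unit_measureT mulr1 -nE.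
move=> s10; case: b2 => [|s0]; first by rewrite -nE.
move/(congr1 size)/eqP: s0; rewrite size_cat addn_eq0 size_eq0.
by rewrite (negPf s10).
Qed.

Lemma iso_bounds (W : normedModType R) (Z : closedSubspace W) :
  isomorphic_to_subspace (L1 R) Z ->
  exists (T : {linear L1 R -> W}) (C c : R), [/\ 0 < C, 0 < c,
    forall f, `|T f| <= C * `|f| & forall f, c * `|f| <= `|T f|].
Proof.
move=> [T [S [TZ TS ST cT cS]]].
have [C [C0 TC]] : exists C, 0 < C /\ forall f, `|T f| <= C * `|f|.
  have /linear_boundedP : bounded_near T (nbhs 0) by apply/linear_bounded_continuous.
  move=> [r [_ hr]]; exists (Num.max 1 (r + 1)); split; first by rewrite lt_max ltr01.
  by apply: hr; rewrite lt_max ltrDl ltr01 orbT.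
have [c [c0 Sc]] : exists c, 0 < c /\ forall f, `|T f| < c -> `|f| < 1.
  have S0 : S 0 = 0 by rewrite -(linear0 T) TS.
  have Z0 : [set z | z \in Z] 0 by rewrite /= -(linear0 T) TZ.
  move/subspace_continuousP : cS => /(_ 0 Z0).
  move=> /cvgrPdist_lt/(_ 1 ltr01); rewrite near_withinE => /nbhs_ballP[c /= c0 hc].
  exists c; split=> // f fc; have := hc (T f); rewrite /from_subspace S0 sub0r normrN TS; apply.
    by rewrite -ball_normE /= sub0r normrN.
  exact: TZ.
exists T, C, c; split=> // f; have [->|f0] := eqVneq f 0.
  by rewrite linear0 !normr0 mulr0.
have nf : 0 < `|f| by rewrite normr_gt0.
rewrite leNgt; apply/negP => lt.
have : `| (`|f|^-1 *: f) | < 1.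
  apply: Sc; rewrite [X in `|X|]linearZ/= normrZ gtr0_norm ?invr_gt0//.
  by rewrite mulrC ltr_pdivrMr.
by rewrite normrZ gtr0_norm ?invr_gt0// mulVf ?gt_eqF// ltxx.
Qed.

(** The images T (f m) of the waves are separated, so by [separated_l1_sums]
    some signed sum of 2 K^2 of their approximants has norm of order K^2, while
    the corresponding signed sum of waves has norm at most K by
    [L1_wave_sums]. *)
Lemma no_L1_copy (W : normedModType R) (j : {poly R} -> W) :
  (forall a x v, j (a *: x + v) = a *: j x + j v) ->
  (forall x, `|j x| = poly_norm x) ->
  (forall q e, 0 < e -> exists x, `|q - j x| < e) ->
  ~ exists Z : closedSubspace W, isomorphic_to_subspace (L1 R) Z.
Proof.
move=> j_lin j_norm j_dense [Z /iso_bounds[T [C [c [C0 c0 TC Tc]]]]].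
have [f hf] := L1_wave_exists.
have sums := L1_wave_sums hf.
pose e := c / 64; have e0 : 0 < e by rewrite divr_gt0.
have [v hv] := choice (fun m => j_dense (T (f m)) e e0).
have jB := isometryB j_lin j_norm.
have f1 m : `|f m| <= 1.
  have [+ _] := sums [:: m] [::] 1 isT.
  by rewrite big_seq1 big_nil subr0/= expr1n; lra.
have vB m : poly_norm (v m) <= C + e.
  rewrite -j_norm; have := ler_normB (T (f m)) (T (f m) - j (v m)); rewrite subKr.
  have := TC (f m); have := hv m; have : C * `|f m| <= C by rewrite ler_piMr// ltW.
  lra.
have vc m l : m != l -> c / 4 <= poly_norm (v m - v l).
  move=> ml; have us : uniq ([:: m] ++ [:: l]) by rewrite /= inE ml.
  have [_ /(_ isT)] := sums [:: m] [:: l] 0 us; rewrite !big_seq1 => h.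
  have h1 := Tc (f m - f l); rewrite linearB/= in h1.
  have h2 : c * (1 / 2) <= c * `|f m - f l| by rewrite ler_pM2l.
  rewrite -j_norm jB.
  have h3 : `|T (f m) - T (f l)| <=
      `|j (v m) - j (v l)| + (`|T (f m) - j (v m)| + `|T (f l) - j (v l)|).
    have -> : T (f m) - T (f l) =
        (j (v m) - j (v l)) + ((T (f m) - j (v m)) - (T (f l) - j (v l))).
      by rewrite subr_interchange [RHS]addrC subrK.
    by rewrite (le_trans (ler_normD _ _))// lerD2l ler_normB.
  have := hv m; have := hv l; rewrite /e; lra.
have c4 : 0 < c / 4 by rewrite divr_gt0.
(* The norm of the signed sum is at least K^2 * c / 16, and at most
   C * K + 2 * K^2 * e with e = c / 64. *)
pose K := (Num.trunc (32 * C / c)).+1.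
have K0 : 0 < K%:R :> R by rewrite ltr0n.
have hK : 32 * C < K%:R * c by rewrite -ltr_pdivrMr// truncnS_gt.
have [s1 [s2 [sz1 sz2 us hs]]] := separated_l1_sums vB c4 vc (K * K)%N.
have [hn _] := sums s1 s2 K%:R us.
rewrite size_cat sz1 sz2 in hn.
set F := \sum_(m <- s1) f m - \sum_(m <- s2) f m in hn.
have FK : `|F| <= K%:R.
  rewrite -(ler_pM2l (_ : 0 < 2 * K%:R)) ?mulr_gt0//.
  by apply: (le_trans hn); rewrite natrD natrM expr2; lra.
have approx s : `|\sum_(m <- s) T (f m) - \sum_(m <- s) j (v m)| <= (size s)%:R * e.
  rewrite -sumrB (le_trans (ler_norm_sum _ _ _))//.
  elim: s => [|m s IH]; first by rewrite big_nil mul0r.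
  by rewrite big_cons -natr1 mulrDl mul1r addrC lerD// ltW.
have a1 := approx s1; have a2 := approx s2; rewrite sz1 sz2 in a1 a2.
have jE : j (\sum_(m <- s1) v m - \sum_(m <- s2) v m) =
    \sum_(m <- s1) j (v m) - \sum_(m <- s2) j (v m).
  by rewrite jB !(isometry_sum j_lin j_norm).
have TE : T F = \sum_(m <- s1) T (f m) - \sum_(m <- s2) T (f m).
  by rewrite /F linearB/= !linear_sum.
have h3 : `|j (\sum_(m <- s1) v m - \sum_(m <- s2) v m)| <= `|T F| + 2 * ((K * K)%:R * e).
  rewrite jE TE; set x1 := \sum_(m <- s1) T _ in a1 *; set x2 := \sum_(m <- s2) T _ in a2 *.
  set y1 := \sum_(m <- s1) j _ in a1 *; set y2 := \sum_(m <- s2) j _ in a2 *.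
  have -> : y1 - y2 = (x1 - x2) - ((x1 - y1) - (x2 - y2)).
    by rewrite (subr_interchange x1 y1 x2 y2) subKr.
  rewrite (le_trans (ler_normB _ _))// lerD2l (le_trans (ler_normB _ _))//; lra.
rewrite j_norm in h3; have h4 := TC F.
have h5 : C * `|F| <= C * K%:R by rewrite ler_pM2l.
have KK : (K * K)%:R = K%:R * K%:R :> R by rewrite natrM.
have : K%:R * (K%:R * c) <= K%:R * (32 * C).
  rewrite KK /e in hs h3; lra.
by rewrite ler_pM2l// leNgt hK.
Qed.

End isomorphic_copies.

(** * The quotient of L1 *)

Section L1_quotient.
Context (R : realType).
Local Notation unit_measure :=
  (mrestr (@lebesgue_measure R) (measurable_itv `[0%R : R, 1%R])).

Lemma L1_quotient_model :
  exists (Y : closedSubspace (L1 R)) (j : {poly R} -> quotient_space Y),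
  [/\ forall a x y, j (a *: x + y) = a *: j x + j y,
      forall x, `|j x| = poly_norm x
    & forall q e, 0 < e -> exists x, `|q - j x| < e].
Proof.
have mI := @measurable_shell R.
have tI : trivIset setT (@shell R) by exact: trivIset_seqDU.
have fI n : (unit_measure (@shell R n) < +oo)%E by apply: unit_measure_fin; exact: mI.
have gI := @unit_measure_shell_gt0 R.
have UI := bigcup_shell R.
pose cf n (f : L1 R) : R :=
  \int[unit_measure]_(x in @shell R n) ((f : LspaceType1 unit_measure) : R -> R) x.
have /choice[g hg] := @L1_bump _ _ _ unit_measure _ mI tI gI fI.
apply: (@poly_quotient_model R (L1 R) cf g).
- by move=> n a f h; exact: (@L1_Rintegral_lin _ _ _ unit_measure _ a f h (mI n)).
- by move=> N f; exact: (@L1_coef_sum _ _ _ unit_measure _ mI tI UI N f).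
- by move=> n; have [] := hg n.
- by move=> m n; have [_] := hg n; exact.
- by move=> f e; exact: (@L1_tail _ _ _ unit_measure _ mI tI UI f e).
Qed.

End L1_quotient.

Theorem theorem3p4 (R : realType) :
  exists Y : closedSubspace (L1 R),
    [/\ exists q : quotient_space Y, q != 0,
        daugavet_property (quotient_space Y)
      & ~ exists Z : closedSubspace (quotient_space Y),
            isomorphic_to_subspace (L1 R) Z].
Proof.
have [Y [j [j_lin j_norm j_dense]]] := L1_quotient_model R.
exists Y; split.
- exact: isometry_neq0 j_norm.
- exact: isometry_daugavet j_lin j_norm j_dense.
- exact: no_L1_copy j_lin j_norm j_dense.
Qed.
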